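(* Let $k$ and $l$ be positive integers with $k<l$. Then $\mathrm{Sp}(2k+l)$ admits at least two (counted up to scaling by positive constants) non-naturally reductive left-invariant Einstein metrics which are $\mathrm{Ad}(\mathrm{Sp}(k)\times\mathrm{Sp}(k)\times\mathrm{Sp}(l))$-invariant, where $\mathrm{Sp}(k)\times\mathrm{Sp}(k)\times\mathrm{Sp}(l)$ is embedded block-diagonally in $\mathrm{Sp}(2k+l)$.
   Context: $\mathrm{Sp}(n)$ is the compact symplectic group, i.e. the group of $n\times n$ quaternionic matrices $A$ with $A^*A=I$, and $\mathfrak{sp}(n)$ is its Lie algebra. A left-invariant Riemannian metric on a Lie group $G$ is identified with an inner product on its Lie algebra $\mathfrak g$; for a closed subgroup $H\subset G$ it is called $\mathrm{Ad}(H)$-invariant if this inner product is invariant under $\mathrm{Ad}(h)$ for every $h\in H$. A Riemannian metric $g$ is Einstein if its Ricci tensor $r$ satisfies $r=\lambda g$ for some constant $\lambda\in\mathbb R$. Naturally reductive left-invariant metrics: let $G$ be a compact simple Lie group with Lie algebra $\mathfrak g$, and let $B$ be the negative of the Killing form of $\mathfrak g$. A left-invariant metric $\langle\cdot,\cdot\rangle$ on $G$ is naturally reductive if there is a closed subgroup $K$ of $G$ such that it is naturally reductive as a homogeneous metric with respect to the action $(g,k)\cdot y=gyk^{-1}$ of $G\times K$ on $G$. By a theorem of D'Atri and Ziller, this is equivalent to the existence of a closed subgroup $K$ of $G$, with Lie algebra $\mathfrak k=\mathfrak k_0\oplus\mathfrak k_1\oplus\cdots\oplus\mathfrak k_p$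 ($\mathfrak k_0$ the center of $\mathfrak k$, and $\mathfrak k_1,\dots,\mathfrak k_p$ the simple ideals of $\mathfrak k$) and $B$-orthogonal complement $\mathfrak m$ in $\mathfrak g$, such that $$\langle\cdot,\cdot\rangle=u_0\,b|_{\mathfrak k_0}+u_1B|_{\mathfrak k_1}+\cdots+u_pB|_{\mathfrak k_p}+xB|_{\mathfrak m}$$ for some inner product $b$ on $\mathfrak k_0$ and some positive reals $u_0,\dots,u_p,x$. A left-invariant metric is non-naturally reductive if it is not naturally reductive. *)

(* Defs.v *)
From HB Require Import structures.
From mathcomp Require Import all_boot all_order all_algebra.
From mathcomp Require Import ring.
From mathcomp Require Import all_classical all_reals all_analysis.
Import Order.TTheory GRing.Theory Num.Theory.
Import numFieldNormedType.Exports.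

Set Implicit Arguments.
Unset Strict Implicit.
Unset Printing Implicit Defensive.

Local Open Scope classical_set_scope.
Local Open Scope ring_scope.

(* Hamilton's quaternions: the row vector (a, b, c, d) stands for
   a + b i + c j + d k. The additive, real-linear and topological structures
   are those of R^4. *)

Definition quat (R : realType) := 'rV[R]_4.

HB.instance Definition _ (R : realType) := GRing.Zmodule.copy (quat R) 'rV[R]_4.
HB.instance Definition _ (R : realType) := GRing.Lmodule.copy (quat R) 'rV[R]_4.
HB.instance Definition _ (R : realType) := PseudoMetric.copy (quat R) 'rV[R]_4.

Section Quaternion.
Variable R : realType.
Implicit Types p q : quat R.

Definition qcoord q (c : 'I_4) : R := (q : 'rV[R]_4) ord0 c.

Definition mkquat (a b c d : R) : quat R := \row_(i < 4) [:: a; b; c; d]`_i.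

Definition qre q : R := qcoord q (inord 0).
Definition qi q : R := qcoord q (inord 1).
Definition qj q : R := qcoord q (inord 2).
Definition qk q : R := qcoord q (inord 3).

Definition qone : quat R := mkquat 1 0 0 0.

Definition qmul p q : quat R := mkquat
  (qre p * qre q - qi p * qi q - qj p * qj q - qk p * qk q)
  (qre p * qi q + qi p * qre q + qj p * qk q - qk p * qj q)
  (qre p * qj q - qi p * qk q + qj p * qre q + qk p * qi q)
  (qre p * qk q + qi p * qj q - qj p * qi q + qk p * qre q).

Definition qconj q : quat R := mkquat (qre q) (- qi q) (- qj q) (- qk q).

Lemma quatP p q :
  [/\ qre p = qre q, qi p = qi q, qj p = qj q & qk p = qk q] -> p = q.
Proof.
case=> h0 h1 h2 h3; apply/rowP => -[m lt_m].
case: m lt_m => [|[|[|[|//]]]] lt_m.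
- have -> : Ordinal lt_m = inord 0 by apply/val_inj; rewrite /= inordK.
  exact: h0.
- have -> : Ordinal lt_m = inord 1 by apply/val_inj; rewrite /= inordK.
  exact: h1.
- have -> : Ordinal lt_m = inord 2 by apply/val_inj; rewrite /= inordK.
  exact: h2.
- have -> : Ordinal lt_m = inord 3 by apply/val_inj; rewrite /= inordK.
  exact: h3.
Qed.

Lemma qre_mk a b c d : qre (mkquat a b c d) = a.
Proof. by rewrite /qre /qcoord mxE inordK. Qed.
Lemma qi_mk a b c d : qi (mkquat a b c d) = b.
Proof. by rewrite /qi /qcoord mxE inordK. Qed.
Lemma qj_mk a b c d : qj (mkquat a b c d) = c.
Proof. by rewrite /qj /qcoord mxE inordK. Qed.
Lemma qk_mk a b c d : qk (mkquat a b c d) = d.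
Proof. by rewrite /qk /qcoord mxE inordK. Qed.

Definition qmkE := (qre_mk, qi_mk, qj_mk, qk_mk).

Lemma qcoordD p q c : qcoord (p + q) c = qcoord p c + qcoord q c.
Proof. by rewrite /qcoord mxE. Qed.
Lemma qcoordZ a q c : qcoord (a *: q) c = a * qcoord q c.
Proof. by rewrite /qcoord mxE. Qed.

Lemma qreD p q : qre (p + q) = qre p + qre q. Proof. exact: qcoordD. Qed.
Lemma qiD p q : qi (p + q) = qi p + qi q. Proof. exact: qcoordD. Qed.
Lemma qjD p q : qj (p + q) = qj p + qj q. Proof. exact: qcoordD. Qed.
Lemma qkD p q : qk (p + q) = qk p + qk q. Proof. exact: qcoordD. Qed.

Lemma qmulA : associative qmul.
Proof. by move=> p q r; apply: quatP; rewrite !qmkE; split; ring. Qed.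
Lemma qmul1q : left_id qone qmul.
Proof. by move=> p; apply: quatP; rewrite !qmkE; split; ring. Qed.
Lemma qmulq1 : right_id qone qmul.
Proof. by move=> p; apply: quatP; rewrite !qmkE; split; ring. Qed.
Lemma qmulDl : left_distributive qmul +%R.
Proof.
move=> p q r; apply: quatP.
by split; rewrite ?(qreD, qiD, qjD, qkD) !qmkE !(qreD, qiD, qjD, qkD); ring.
Qed.
Lemma qmulDr : right_distributive qmul +%R.
Proof.
move=> p q r; apply: quatP.
by split; rewrite ?(qreD, qiD, qjD, qkD) !qmkE !(qreD, qiD, qjD, qkD); ring.
Qed.
Lemma qone_neq0 : qone != 0.
Proof.
apply/eqP => /(congr1 qre); rewrite qmkE /qre /qcoord mxE => /eqP.
by rewrite oner_eq0.
Qed.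

HB.instance Definition _ := GRing.Zmodule_isNzRing.Build (quat R)
  qmulA qmul1q qmulq1 qmulDl qmulDr qone_neq0.

End Quaternion.

(* n x n quaternionic matrices as a real vector space. A separate name is needed
   because 'M[quat R]_n already carries a module structure over quat R; the
   topology is the library's topology on 'M[quat R]_n. *)

Definition qmx (R : realType) (n : nat) := 'M[quat R]_n.

HB.instance Definition _ R n := GRing.Zmodule.copy (qmx R n) 'M[quat R]_n.
HB.instance Definition _ R n := PseudoMetric.copy (qmx R n) 'M[quat R]_n.

Section QMatrixModule.
Variables (R : realType) (n : nat).
Implicit Types A B : qmx R n.

Definition qmx_scale (a : R) A : qmx R n := \matrix_(i, j) (a *: A i j).

Lemma qmx_scaleA a b A : qmx_scale a (qmx_scale b A) = qmx_scale (a * b) A.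
Proof. by apply/matrixP => i j; rewrite !mxE scalerA. Qed.
Lemma qmx_scale1 : left_id 1 qmx_scale.
Proof. by move=> A; apply/matrixP => i j; rewrite mxE scale1r. Qed.
Lemma qmx_scaleDr : right_distributive qmx_scale +%R.
Proof. by move=> a A B; apply/matrixP => i j; rewrite !mxE scalerDr. Qed.
Lemma qmx_scaleDl A : {morph qmx_scale^~ A : a b / a + b}.
Proof. by move=> a b; apply/matrixP => i j; rewrite !mxE scalerDl. Qed.

HB.instance Definition _ := GRing.Zmodule_isLmodule.Build R (qmx R n)
  qmx_scaleA qmx_scale1 qmx_scaleDr qmx_scaleDl.

Let I := ('I_n * 'I_n * 'I_4)%type.

Lemma qmx_vect_axiom : Vector.axiom #|{: I}| (qmx R n).
Proof.
pose f A : 'rV[R]_#|{: I}| :=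
  \row_m qcoord (A (enum_val m).1.1 (enum_val m).1.2) (enum_val m).2.
exists f.
  by move=> a A B; apply/rowP => m; rewrite !mxE qcoordD qcoordZ.
exists (fun v : 'rV[R]_#|{: I}| =>
  \matrix_(i, j) ((\row_c v ord0 (enum_rank ((i, j, c) : I))) : quat R)).
  move=> A; apply/matrixP => i j; apply/rowP => c.
  by rewrite !mxE enum_rankK.
move=> v; apply/rowP => m; rewrite mxE /qcoord !mxE.
by rewrite -!surjective_pairing enum_valK.
Qed.

HB.instance Definition _ := Lmodule_hasFinDim.Build R (qmx R n) qmx_vect_axiom.

End QMatrixModule.

Section CompactSymplectic.
Variables (R : realType) (n : nat).
Implicit Types A B X Y : 'M[quat R]_n.

Definition qadj m p (A : 'M[quat R]_(m, p)) : 'M[quat R]_(p, m) :=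
  (map_mx (@qconj R) A)^T.

Definition Sp : set 'M[quat R]_n := [set A | qadj A *m A = 1%:M].

Definition qadj_add (X : qmx R n) : qmx R n := qadj X + X.

Lemma qconj_linear a p q : @qconj R (a *: p + q) = a *: qconj p + qconj q.
Proof.
apply: quatP; rewrite !qmkE !(qreD, qiD, qjD, qkD).
rewrite /qre /qi /qj /qk !qcoordZ -!/(qre _) -!/(qi _) -!/(qj _) -!/(qk _) !qmkE.
by split; ring.
Qed.

Lemma qadj_add_linear : linear qadj_add.
Proof.
move=> a X Y; apply/matrixP => i j.
by rewrite !mxE qconj_linear scalerDr addrACA.
Qed.

HB.instance Definition _ :=
  GRing.isLinear.Build R (qmx R n) (qmx R n) _ qadj_add qadj_add_linear.

(* sp(n): the skew-Hermitian quaternionic matrices (see mem_sp). *)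
Definition sp_space : {vspace qmx R n} := lker (linfun qadj_add).

Definition sp := subvs_of sp_space.

Lemma mem_sp (X : qmx R n) : X \in sp_space <-> qadj X = - X.
Proof.
rewrite /sp_space memv_ker lfunE /= /qadj_add addr_eq0.
by split=> [/eqP|->].
Qed.

Lemma qconjM p q : @qconj R (p * q) = qconj q * qconj p.
Proof. by apply: quatP; rewrite !qmkE; split; ring. Qed.

Lemma qconjK : involutive (@qconj R).
Proof. by move=> p; apply: quatP; rewrite !qmkE; split; ring. Qed.

Lemma qconjD p q : @qconj R (p + q) = qconj p + qconj q.
Proof. by have := qconj_linear 1 p q; rewrite !scale1r. Qed.

Lemma qconj0 : @qconj R 0 = 0.
Proof.
by have := qconjD 0 0; rewrite addr0 -[LHS]addr0 => /addrI.
Qed.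

Lemma qadjM A B : qadj (A *m B) = qadj B *m qadj A.
Proof.
apply/matrixP => i j; rewrite !mxE (big_morph _ qconjD qconj0).
by apply: eq_bigr => l _; rewrite !mxE qconjM.
Qed.

Lemma qadjK A : qadj (qadj A) = A.
Proof. by apply/matrixP => i j; rewrite !mxE qconjK. Qed.

Lemma qadjD A B : qadj (A + B) = qadj A + qadj B.
Proof. by apply/matrixP => i j; rewrite !mxE qconjD. Qed.

Lemma qadjN A : qadj (- A) = - qadj A.
Proof.
apply/eqP; rewrite -addr_eq0 -qadjD addNr; apply/eqP/matrixP => i j.
by rewrite !mxE qconj0.
Qed.

(* vsproj lands in sp(n) without changing its argument: see val_sp_br, val_Ad. *)
Definition sp_br (x y : sp) : sp :=
  vsproj sp_space (vsval x *m vsval y - vsval y *m vsval x).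

(* Only used for h in Sp(n), whose inverse is qadj h. *)
Definition Ad (h : 'M[quat R]_n) (x : sp) : sp :=
  vsproj sp_space (h *m vsval x *m qadj h).

Lemma val_sp_br x y :
  vsval (sp_br x y) = vsval x *m vsval y - vsval y *m vsval x :> 'M[quat R]_n.
Proof.
rewrite /sp_br vsprojK //; apply/mem_sp.
have /mem_sp ex := subvsP x; have /mem_sp ey := subvsP y.
by rewrite qadjD qadjN !qadjM ex ey !mulmxN !mulNmx !opprK opprB.
Qed.

Lemma val_Ad h x : vsval (Ad h x) = h *m vsval x *m qadj h :> 'M[quat R]_n.
Proof.
rewrite /Ad vsprojK //; apply/mem_sp.
have /mem_sp ex := subvsP x.
by rewrite !qadjM qadjK ex !mulNmx !mulmxN mulmxA.
Qed.

Definition closed_subgroup (K : set 'M[quat R]_n) : Prop :=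
  [/\ K `<=` Sp, closed K, K 1%:M,
      (forall a b, K a -> K b -> K (a *m b)) & (forall a, K a -> K (qadj a))].

(* The Lie algebra of K: velocities at 0 of the one-parameter subgroups of K;
   derivatives are taken coordinatewise. *)
Definition in_lie (K : set 'M[quat R]_n) (x : sp) : Prop :=
  exists gam : R -> 'M[quat R]_n,
  [/\ forall t, K (gam t),
      forall s t, gam (s + t) = gam s *m gam t &
      forall i j c, is_derive (0 : R) (1 : R)
        (fun t : R => qcoord (gam t i j) c) (qcoord ((vsval x : qmx R n) i j) c)].

Definition Ad_invariant (H : set 'M[quat R]_n) (ip : sp -> sp -> R) : Prop :=
  forall h, H h -> forall x y, ip (Ad h x) (Ad h y) = ip x y.

End CompactSymplectic.

(* A left-invariant metric on a Lie group is an inner product on the Lie algebra g,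
   and its Levi-Civita connection and curvature are determined by their values on
   left-invariant vector fields, i.e. on elements of g. *)
Section LeftInvariantMetric.
Variables (R : realType) (g : vectType R) (br : g -> g -> g).

Definition inner_product (ip : g -> g -> R) : Prop :=
  [/\ forall x y, ip x y = ip y x,
      forall a x y z, ip (a *: x + y) z = a * ip x z + ip y z &
      forall x, x != 0 -> 0 < ip x x].

(* The left-invariant functions ip y z are constant, so compatibility with the
   metric has no derivative term. *)
Definition levi_civita (ip : g -> g -> R) (D : g -> g -> g) : Prop :=
  [/\ forall a x y z, D (a *: x + y) z = a *: D x z + D y z,
      forall a x y z, D x (a *: y + z) = a *: D x y + D x z,
      forall x y, D x y - D y x = br x y &
      forall x y z, ip (D x y) z + ip y (D x z) = 0].

Definition curvature (D : g -> g -> g) (x y z : g) : g :=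
  D x (D y z) - D y (D x z) - D (br x y) z.

Definition lin_trace (f : g -> g) : R :=
  \sum_(i < \dim {:g}) coord (vbasis {:g}) i (f (vbasis {:g})`_i).

Definition ricci (D : g -> g -> g) (y z : g) : R :=
  lin_trace (fun x => curvature D x y z).

(* The Levi-Civita connection D exists and is unique. *)
Definition einstein (ip : g -> g -> R) : Prop :=
  exists D, levi_civita ip D /\
  exists lambda : R, forall y z, ricci D y z = lambda * ip y z.

End LeftInvariantMetric.

(* Natural reductivity of a metric on G = Sp(n) for the action
   (a, h) . y = a y h^-1 of G x K. At the base point 1, the orbit map has
   differential (x, y) |-> x - y from Lie(G x K) to g = T_1 G, and the isotropy group
   is {(h, h) | h in K}. *)
Section NaturallyReductive.
Variables (R : realType) (n : nat).
Local Notation g := (sp R n).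

Definition prod_br (u v : g * g) : g * g :=
  (sp_br u.1 v.1, sp_br u.2 v.2).

Definition orbit_diff (u : g * g) : g := u.1 - u.2.

(* k is Lie(K), so gk = g (+) k is Lie(G x K); h is the isotropy algebra, m a
   reductive complement of it, and daddv_pi m h the projection of gk onto m along
   h. The metric on m is ip pulled back by orbit_diff; the action is isometric iff
   ip is Ad(K)-invariant. *)
Definition naturally_reductive_wrt (K : set 'M[quat R]_n) (ip : g -> g -> R) :
    Prop :=
  Ad_invariant K ip /\
  exists (k : {vspace g}) (gk h m : {vspace (g * g)%type}),
  [/\ forall x, x \in k <-> in_lie K x,
      forall u, u \in gk <-> u.2 \in k,
      forall u, u \in h <-> u.1 = u.2 /\ u.2 \in k,
      (m + h)%VS = gk /\ (m :&: h)%VS = 0%VS &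
      (forall a, K a -> forall u, u \in m -> (Ad a u.1, Ad a u.2) \in m) /\
      forall w u v, w \in m -> u \in m -> v \in m ->
        ip (orbit_diff (daddv_pi m h (prod_br w u))) (orbit_diff v) +
        ip (orbit_diff u) (orbit_diff (daddv_pi m h (prod_br w v))) = 0].

Definition naturally_reductive (ip : g -> g -> R) : Prop :=
  exists K, closed_subgroup K /\ naturally_reductive_wrt K ip.

End NaturallyReductive.

Definition block_Sp (R : realType) (k1 k2 l : nat) :
    set 'M[quat R]_(k1 + k2 + l) :=
  [set h | exists a b c, [/\ Sp a, Sp b, Sp c &
     h = block_mx (block_mx a 0 0 b) 0 0 c]].
Arguments block_Sp R k1 k2 l : clear implicits.

Definition homothetic (R : realType) (g : vectType R) (ip1 ip2 : g -> g -> R) :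
    Prop :=
  exists2 c : R, 0 < c & forall x y, ip1 x y = c * ip2 x y.

(* Main.v *)
(* A symmetric positive weight s on pairs of indices defines the inner product
   <x, y> = sum_ij s_ij Re(conj(x_ij) y_ij) on sp(n). Its Ricci tensor is again diagonal,
     Ric(y, z) = sum_im rho_im Re(conj(y_im) z_im),
     rho_im = 2(n+1) - (s_ii + s_mm)/(2 s_im)
              + sum_j (s_im^2/(s_ij s_mj) - s_ij/s_mj - s_mj/s_ij),
   which follows from Ric(y, z) = tr(x |-> R(x,y)z) and the traces of P ad_y Q ad_z for
   diagonal P, Q. For weights depending only on the blocks k, k, l and invariant under the
   exchange of the first two, the Einstein equations reduce to one polynomial equation in
   the weight y of the part between the two copies of sp(k), when the remaining off-diagonal
   weights are 1. Its polynomial is negative at y = 1 and positive near 0 and at infinity,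
   so that there are solutions y < 1 and y > 1.

   If the metric is naturally reductive with respect to K, the reductive complement is the
   graph of a map phi : g -> k, and T = (1 + phi) Lambda^-1 satisfies [Tx, y] = [x, Ty].
   Then T has a common eigenvalue t on the rotations in the planes (1,2) and (1,3) through
   the three blocks, so that (t - 1/s_12) E and (t - 1/s_13) E' lie in k for these
   rotations E, E'. Since Lambda commutes with ad k, this forces y = 1 or y = u, the
   weight of the two copies of sp(k). *)
Require Import Defs.
From mathcomp Require Import all_boot all_order all_algebra.
From mathcomp Require Import ring lra.
From mathcomp Require Import all_classical all_reals all_analysis.
Import Order.TTheory GRing.Theory Num.Theory.
Import numFieldNormedType.Exports.
Set Implicit Arguments.
Unset Strict Implicit.
Unset Printing Implicit Defensive.
Local Open Scope classical_set_scope.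
Local Open Scope ring_scope.

(** * Quaternions and quaternionic matrices *)

Section QuaternionDot.
Variable R : realType.
Implicit Types (p q : quat R) (a b : R).

Lemma qreM p q : qre (p * q) =
  qre p * qre q - qi p * qi q - qj p * qj q - qk p * qk q.
Proof. exact: qre_mk. Qed.
Lemma qiM p q : qi (p * q) =
  qre p * qi q + qi p * qre q + qj p * qk q - qk p * qj q.
Proof. exact: qi_mk. Qed.
Lemma qjM p q : qj (p * q) =
  qre p * qj q - qi p * qk q + qj p * qre q + qk p * qi q.
Proof. exact: qj_mk. Qed.
Lemma qkM p q : qk (p * q) =
  qre p * qk q + qi p * qj q - qj p * qi q + qk p * qre q.
Proof. exact: qk_mk. Qed.

Lemma qreZ a p : qre (a *: p) = a * qre p. Proof. exact: qcoordZ. Qed.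
Lemma qiZ a p : qi (a *: p) = a * qi p. Proof. exact: qcoordZ. Qed.
Lemma qjZ a p : qj (a *: p) = a * qj p. Proof. exact: qcoordZ. Qed.
Lemma qkZ a p : qk (a *: p) = a * qk p. Proof. exact: qcoordZ. Qed.

Lemma qcoordN p c : qcoord (- p) c = - qcoord p c.
Proof. by rewrite /qcoord mxE. Qed.
Lemma qcoord0 c : qcoord (0 : quat R) c = 0.
Proof. by rewrite /qcoord mxE. Qed.
Lemma qreN p : qre (- p) = - qre p. Proof. exact: qcoordN. Qed.
Lemma qiN p : qi (- p) = - qi p. Proof. exact: qcoordN. Qed.
Lemma qjN p : qj (- p) = - qj p. Proof. exact: qcoordN. Qed.
Lemma qkN p : qk (- p) = - qk p. Proof. exact: qcoordN. Qed.

Lemma qre_conj p : qre (qconj p) = qre p. Proof. exact: qre_mk. Qed.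
Lemma qi_conj p : qi (qconj p) = - qi p. Proof. exact: qi_mk. Qed.
Lemma qj_conj p : qj (qconj p) = - qj p. Proof. exact: qj_mk. Qed.
Lemma qk_conj p : qk (qconj p) = - qk p. Proof. exact: qk_mk. Qed.

Lemma qconjZ a p : qconj (a *: p) = a *: qconj p.
Proof.
by have := qconj_linear a p 0; rewrite addr0 qconj0 addr0.
Qed.

Lemma qconjN p : qconj (- p) = - qconj p.
Proof. by rewrite -scaleN1r qconjZ scaleN1r. Qed.

Lemma qre1 : qre (1 : quat R) = 1. Proof. exact: qre_mk. Qed.
Lemma qi1 : qi (1 : quat R) = 0. Proof. exact: qi_mk. Qed.
Lemma qj1 : qj (1 : quat R) = 0. Proof. exact: qj_mk. Qed.
Lemma qk1 : qk (1 : quat R) = 0. Proof. exact: qk_mk. Qed.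

Lemma qre0 : qre (0 : quat R) = 0. Proof. exact: qcoord0. Qed.
Lemma qi0 : qi (0 : quat R) = 0. Proof. exact: qcoord0. Qed.
Lemma qj0 : qj (0 : quat R) = 0. Proof. exact: qcoord0. Qed.
Lemma qk0 : qk (0 : quat R) = 0. Proof. exact: qcoord0. Qed.

Definition qcE := (qreM, qiM, qjM, qkM, qreD, qiD, qjD, qkD, qreN, qiN, qjN, qkN,
  qreZ, qiZ, qjZ, qkZ, qre_conj, qi_conj, qj_conj, qk_conj,
  qre1, qi1, qj1, qk1, qre0, qi0, qj0, qk0, @qmkE R).

Ltac quat_ring := apply: quatP; rewrite !qcE; split; ring.

Lemma qconj1 : qconj (1 : quat R) = 1. Proof. quat_ring. Qed.

Lemma scalerqAl a p q : a *: p * q = a *: (p * q). Proof. quat_ring. Qed.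
Lemma scalerqAr a p q : p * (a *: q) = a *: (p * q). Proof. quat_ring. Qed.

Definition qdot p q : R := qre p * qre q + qi p * qi q + qj p * qj q + qk p * qk q.

Lemma qdotC p q : qdot p q = qdot q p.
Proof. by rewrite /qdot; ring. Qed.
Lemma qdotDl p1 p2 q : qdot (p1 + p2) q = qdot p1 q + qdot p2 q.
Proof. by rewrite /qdot !qcE; ring. Qed.
Lemma qdotDr p q1 q2 : qdot p (q1 + q2) = qdot p q1 + qdot p q2.
Proof. by rewrite /qdot !qcE; ring. Qed.
Lemma qdotZl a p q : qdot (a *: p) q = a * qdot p q.
Proof. by rewrite /qdot !qcE; ring. Qed.
Lemma qdotZr a p q : qdot p (a *: q) = a * qdot p q.
Proof. by rewrite /qdot !qcE; ring. Qed.
Lemma qdotNl p q : qdot (- p) q = - qdot p q.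
Proof. by rewrite /qdot !qcE; ring. Qed.
Lemma qdotNr p q : qdot p (- q) = - qdot p q.
Proof. by rewrite /qdot !qcE; ring. Qed.
Lemma qdot0l q : qdot 0 q = 0.
Proof. by rewrite /qdot !qcE; ring. Qed.
Lemma qdot0r q : qdot q 0 = 0.
Proof. by rewrite /qdot !qcE; ring. Qed.
Lemma qdotMl r p q : qdot (r * p) q = qdot p (qconj r * q).
Proof. by rewrite /qdot !qcE; ring. Qed.
Lemma qdot_conj p q : qdot (qconj p) (qconj q) = qdot p q.
Proof. by rewrite /qdot !qcE; ring. Qed.
Lemma qdot_ge0 p : 0 <= qdot p p.
Proof. by rewrite /qdot; nra. Qed.
Lemma qdot_eq0 p : qdot p p = 0 -> p = 0.
Proof.
rewrite /qdot => h.
have h0 : qre p = 0 by nra.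
have h1 : qi p = 0 by nra.
have h2 : qj p = 0 by nra.
have h3 : qk p = 0 by nra.
by apply: quatP; rewrite !qcE.
Qed.

Lemma qdot_suml I (s : seq I) (P : pred I) F q :
  qdot (\sum_(i <- s | P i) F i) q = \sum_(i <- s | P i) qdot (F i) q.
Proof.
exact: (big_morph (fun p => qdot p q) (fun p1 p2 => qdotDl p1 p2 q) (qdot0l q)).
Qed.
Lemma qdot_sumr I (s : seq I) (P : pred I) F q :
  qdot q (\sum_(i <- s | P i) F i) = \sum_(i <- s | P i) qdot q (F i).
Proof.
exact: (big_morph (qdot q) (qdotDr q) (qdot0r q)).
Qed.

Definition qunit (c : 'I_4) : quat R := mkquat (c == 0 :> nat)%:R (c == 1 :> nat)%:R
  (c == 2 :> nat)%:R (c == 3 :> nat)%:R.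

Lemma sum_qunit (F : quat R -> R) : \sum_(c < 4) F (qunit c) =
  F (mkquat 1 0 0 0) + F (mkquat 0 1 0 0) + F (mkquat 0 0 1 0) + F (mkquat 0 0 0 1).
Proof. by rewrite !big_ord_recl big_ord0 addr0 /qunit /= !addrA. Qed.

Lemma qdot_unit p c : qdot p (qunit c) = qcoord p c.
Proof.
rewrite /qdot /qunit !qmkE; case: c => [[|[|[|[|//]]]] lt_c] /=;
  rewrite !(mulr0, mulr1, addr0, add0r); congr qcoord; apply: val_inj;
  by rewrite /= inordK.
Qed.

Lemma quat_unit p : p = \sum_(c < 4) qcoord p c *: qunit c.
Proof.
rewrite !big_ord_recl big_ord0 addr0; apply: quatP; rewrite !qcE /=.
rewrite !(mulr0, mulr1, addr0, add0r).
by split; congr qcoord; apply: val_inj; rewrite /= inordK.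
Qed.

End QuaternionDot.

(* The matrix operations below are locked: unification would otherwise compare them
   by unfolding down to quaternion coordinates. *)
Fact mdot_key : unit. Proof. by []. Qed.
Fact mxbr_key : unit. Proof. by []. Qed.
Fact smx_key : unit. Proof. by []. Qed.

(** * Trace form, bracket and diagonal operators *)

Section MatrixDot.
Variables (R : realType) (n : nat).
Local Notation M := 'M[quat R]_n.
Implicit Types (X Y Z A : M) (s : 'I_n -> 'I_n -> R).

(** This is Re tr(X^* Y); on sp(n) it is a positive multiple of the negative of the Killing form. *)
Definition mdot : M -> M -> R :=
  locked_with mdot_key (fun X Y => \sum_i \sum_j qdot (X i j) (Y i j)).

Lemma mdotE X Y : mdot X Y = \sum_i \sum_j qdot (X i j) (Y i j).
Proof. by rewrite /mdot unlock. Qed.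

Lemma mdotC X Y : mdot X Y = mdot Y X.
Proof. by rewrite !mdotE; apply: eq_bigr => i _; apply: eq_bigr => j _; exact: qdotC. Qed.
Lemma mdotDl X Y Z : mdot (X + Y) Z = mdot X Z + mdot Y Z.
Proof.
rewrite !mdotE -big_split; apply: eq_bigr => i _ /=.
by rewrite -big_split; apply: eq_bigr => j _ /=; rewrite mxE qdotDl.
Qed.
Lemma mdotNl X Y : mdot (- X) Y = - mdot X Y.
Proof.
rewrite !mdotE -sumrN; apply: eq_bigr => i _ /=.
by rewrite -sumrN; apply: eq_bigr => j _ /=; rewrite mxE qdotNl.
Qed.
Lemma mdotBl X Y Z : mdot (X - Y) Z = mdot X Z - mdot Y Z.
Proof. by rewrite mdotDl mdotNl. Qed.
Lemma mdotDr X Y Z : mdot X (Y + Z) = mdot X Y + mdot X Z.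
Proof. by rewrite mdotC mdotDl !(mdotC X). Qed.
Lemma mdotNr X Y : mdot X (- Y) = - mdot X Y.
Proof. by rewrite mdotC mdotNl mdotC. Qed.
Lemma mdotBr X Y Z : mdot X (Y - Z) = mdot X Y - mdot X Z.
Proof. by rewrite mdotDr mdotNr. Qed.
Lemma mdot0l X : mdot 0 X = 0.
Proof. by rewrite mdotE big1 // => i _; rewrite big1 // => j _; rewrite mxE qdot0l. Qed.

Lemma mdot_eq0 X : mdot X X = 0 -> X = 0.
Proof.
rewrite mdotE => h; apply/matrixP => i j; rewrite mxE; apply: qdot_eq0.
have h1 : \sum_j qdot (X i j) (X i j) = 0.
  by apply: (psumr_eq0P _ h) => // k _; apply: sumr_ge0 => m _; exact: qdot_ge0.
by apply: (psumr_eq0P _ h1) => // k _; exact: qdot_ge0.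
Qed.

Lemma mdot_mull A X Y : mdot (A *m X) Y = mdot X (qadj A *m Y).
Proof.
rewrite !mdotE.
transitivity (\sum_i \sum_j \sum_k qdot (X k j) (qconj (A i k) * Y i j)).
  apply: eq_bigr => i _; apply: eq_bigr => j _; rewrite mxE qdot_suml.
  by apply: eq_bigr => k _; rewrite qdotMl.
transitivity (\sum_i \sum_k \sum_j qdot (X k j) (qconj (A i k) * Y i j)).
  by apply: eq_bigr => i _; exact: exchange_big.
rewrite exchange_big; apply: eq_bigr => k _ /=.
rewrite exchange_big; apply: eq_bigr => j _ /=.
by rewrite mxE qdot_sumr; apply: eq_bigr => i _; rewrite !mxE.
Qed.

Lemma mdot_adj X Y : mdot (qadj X) (qadj Y) = mdot X Y.
Proof.
rewrite !mdotE exchange_big; apply: eq_bigr => i _; apply: eq_bigr => j _.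
by rewrite !mxE qdot_conj.
Qed.

Lemma mdot_mulr A X Y : mdot (X *m A) Y = mdot X (Y *m qadj A).
Proof. by rewrite -mdot_adj qadjM mdot_mull qadjK -mdot_adj qadjM !qadjK. Qed.

Definition mxbr : M -> M -> M := locked_with mxbr_key (fun X Y => X *m Y - Y *m X).

Lemma mxbrE X Y : mxbr X Y = X *m Y - Y *m X.
Proof. by rewrite /mxbr unlock. Qed.

Lemma mxbrDl X Y Z : mxbr (X + Y) Z = mxbr X Z + mxbr Y Z.
Proof. by rewrite !mxbrE mulmxDl mulmxDr opprD addrACA. Qed.
Lemma mxbrDr X Y Z : mxbr Z (X + Y) = mxbr Z X + mxbr Z Y.
Proof. by rewrite !mxbrE mulmxDl mulmxDr opprD addrACA. Qed.
Lemma mxbrNr X Y : mxbr Y (- X) = - mxbr Y X.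
Proof. by rewrite !mxbrE mulNmx mulmxN opprD. Qed.
Lemma mxbrC X Y : mxbr X Y = - mxbr Y X.
Proof. by rewrite !mxbrE opprB. Qed.

(** The adjoint of multiplication by [Z], on either side, is multiplication by [qadj Z]. Hence ad Z
    is skew on all quaternionic matrices, not only on sp(n). *)
Lemma mdot_brl Z X Y : qadj Z = - Z -> mdot (mxbr Z X) Y = - mdot X (mxbr Z Y).
Proof.
move=> eZ; rewrite !mxbrE mdotBl mdot_mull mdot_mulr eZ mulNmx mulmxN !mdotNr mdotBr.
by rewrite opprD opprK.
Qed.

Lemma qadj_mxbr X Y : qadj X = - X -> qadj Y = - Y -> qadj (mxbr X Y) = - mxbr X Y.
Proof.
by move=> eX eY; rewrite !mxbrE qadjD qadjN !qadjM eX eY !mulmxN !mulNmx !opprK opprB.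
Qed.

(** A constant weight serves as multiplication by a real number, since [*:] on ['M[quat R]_n] takes
    quaternionic scalars. Scalars and diagonal operators then obey the same lemmas. *)
Definition smx : ('I_n -> 'I_n -> R) -> M -> M :=
  locked_with smx_key (fun s X => \matrix_(i, j) (s i j *: X i j)).

Lemma smxE s X i j : smx s X i j = s i j *: X i j.
Proof. by rewrite /smx unlock mxE. Qed.

Lemma smxD s X Y : smx s (X + Y) = smx s X + smx s Y.
Proof. by apply/matrixP => i j; rewrite !(smxE, mxE) scalerDr. Qed.
Lemma smxN s X : smx s (- X) = - smx s X.
Proof. by apply/matrixP => i j; rewrite !(smxE, mxE) scalerN. Qed.
Lemma smx0 s : smx s 0 = 0.
Proof. by apply/matrixP => i j; rewrite !(smxE, mxE) scaler0. Qed.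
Lemma smx_comp s t X : smx s (smx t X) = smx (fun i j => s i j * t i j) X.
Proof. by apply/matrixP => i j; rewrite !(smxE, mxE) scalerA. Qed.
Lemma mdot_smxl s X Y : mdot (smx s X) Y = mdot X (smx s Y).
Proof.
by rewrite !mdotE; apply: eq_bigr => i _; apply: eq_bigr => j _; rewrite !(smxE, mxE) qdotZl qdotZr.
Qed.
Lemma qadj_smx s X : (forall i j, s i j = s j i) -> qadj (smx s X) = smx s (qadj X).
Proof. by move=> sC; apply/matrixP => i j; rewrite !(smxE, mxE) qconjZ sC. Qed.

Lemma skewE X i j : qadj X = - X -> X j i = - qconj (X i j).
Proof. by move/matrixP/(_ j i); rewrite !(smxE, mxE) => ->; rewrite opprK. Qed.

End MatrixDot.

(** * Quaternionic matrix units *)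

Section Units.
Variables (R : realType) (n : nat).
Local Notation M := 'M[quat R]_n.
Implicit Types (X Y Z A : M) (p q s : 'I_n -> 'I_n -> R).

Definition qE (i j : 'I_n) (e : quat R) : M :=
  \matrix_(a, b) (if (a == i) && (b == j) then e else 0).

Lemma qE_smx s i j e : smx s (qE i j e) = smx (fun _ _ => s i j) (qE i j e).
Proof.
apply/matrixP => a b; rewrite !(smxE, mxE).
by case: (a =P i) => [->|_]; case: (b =P j) => [->|_] //=; rewrite !scaler0.
Qed.

Lemma qadj_qE i j e : qadj (qE i j e) = qE j i (qconj e).
Proof.
apply/matrixP => a b; rewrite !(smxE, mxE) andbC.
by case: ifP => _ //; rewrite qconj0.
Qed.

Lemma qE_mxbr Z i j e a b : mxbr Z (qE i j e) a b =
  (if b == j then Z a i * e else 0) - (if a == i then e * Z j b else 0).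
Proof.
rewrite mxbrE !mxE; congr (_ - _).
  rewrite (bigD1 i) //= big1 => [|c ci]; last by rewrite !(smxE, mxE) (negPf ci) /= mulr0.
  by rewrite !(smxE, mxE) eqxx addr0 /=; case: ifP => // _; rewrite mulr0.
rewrite (bigD1 j) //= big1 => [|c ci]; last by rewrite !(smxE, mxE) (negPf ci) andbF mul0r.
by rewrite !(smxE, mxE) eqxx addr0 andbT; case: ifP => // _; rewrite mul0r.
Qed.

Lemma mdot_qE X i j e : mdot X (qE i j e) = qdot (X i j) e.
Proof.
rewrite !mdotE (bigD1 i) //= (bigD1 j) //= !big1.
- by rewrite !(smxE, mxE) !eqxx /= !addr0.
- move=> a ai; rewrite big1 // => b _; by rewrite !(smxE, mxE) (negPf ai) /= qdot0r.
- move=> a ai; by rewrite !(smxE, mxE) (negPf ai) andbF qdot0r.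
Qed.

Lemma mx_unit X : X = \sum_i \sum_j \sum_c smx (fun _ _ => qcoord (X i j) c) (qE i j (qunit R c)).
Proof.
apply/matrixP => a b; rewrite summxE (bigD1 a) //= [X in _ + X]big1; last first.
  move=> i ai; rewrite summxE big1 // => j _; rewrite summxE big1 // => c _.
  by rewrite !(smxE, mxE) eq_sym (negPf ai) scaler0.
rewrite addr0 summxE (bigD1 b) //= [X in _ + X]big1; last first.
  move=> j ai; rewrite summxE big1 // => c _.
  by rewrite !(smxE, mxE) [b == j]eq_sym (negPf ai) andbF scaler0.
rewrite addr0 summxE {1}[X a b]quat_unit; apply: eq_bigr => c _.
by rewrite !(smxE, mxE) !eqxx.
Qed.

End Units.

(** * Traces *)

Section Trace.
Variables (R : realType) (n : nat).
Local Notation M := 'M[quat R]_n.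
Implicit Types (X Y Z A : M) (p q s : 'I_n -> 'I_n -> R).

Lemma sum_if (i : 'I_n) (F : 'I_n -> R) : \sum_a (if a == i then F a else 0) = F i.
Proof. by rewrite -big_mkcond big_pred1_eq. Qed.

Lemma sum2_if (i : 'I_n) (F : 'I_n -> 'I_n -> R) :
  \sum_a \sum_b (if a == i then F a b else 0) = \sum_b F i b.
Proof. by rewrite exchange_big; apply: eq_bigr => b _ /=; rewrite sum_if. Qed.

(** The bracket of [Z] with a unit at (i, j) is supported on column j and row i. The four terms pair
    column with column, column with row, row with column and row with row. *)
Lemma mdot_mxbr_qE q Z Y i j i' j' e e' :
  mdot (smx q (mxbr Z (qE i j e))) (mxbr Y (qE i' j' e')) =
  (if j == j' then \sum_a q a j * qdot (Z a i * e) (Y a i' * e') else 0)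
  - q i' j * qdot (Z i' i * e) (e' * Y j' j)
  - q i j' * qdot (e * Z j j') (Y i i' * e')
  + (if i == i' then \sum_b q i b * qdot (e * Z j b) (e' * Y j' b) else 0).
Proof.
rewrite !mdotE.
transitivity (\sum_a \sum_b (
   (if b == j then if b == j' then q a b * qdot (Z a i * e) (Y a i' * e') else 0 else 0)
 - (if a == i' then if b == j then q a b * qdot (Z a i * e) (e' * Y j' b) else 0 else 0)
 - (if a == i then if b == j' then q a b * qdot (e * Z j b) (Y a i' * e') else 0 else 0)
 + (if a == i then if a == i' then q a b * qdot (e * Z j b) (e' * Y j' b) else 0 else 0))).
  apply: eq_bigr => a _; apply: eq_bigr => b _.
  rewrite smxE qdotZl !qE_mxbr qdotDl qdotNl !qdotDr !qdotNr.
  by do 4 case: ifP => _; rewrite ?qdot0l ?qdot0r; ring.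
under eq_bigr => a _ do rewrite !big_split /= !sumrN.
rewrite !big_split /= !sumrN; congr (_ - _ - _ + _).
- rewrite exchange_big sum2_if; case: ifP => // _; by rewrite big1.
- by rewrite sum2_if sum_if.
- by rewrite sum2_if sum_if.
- by rewrite sum2_if; case: ifP => // _; rewrite big1.
Qed.

Local Ltac qsum F := rewrite (sum_qunit F) /qdot !qcE; ring.

(** Contractions over e in {1, i, j, k}. After moving all factors e to one side they rest on the
    sums of |e|^2, e y e^*, e e and e y e, which are 4, 4 Re y, -2 and -2 y^*. *)
Lemma sum_qdot_rr (z y : quat R) :
  \sum_(c < 4) qdot (z * qunit R c) (y * qunit R c) = 4 * qdot z y.
Proof. qsum (fun e => qdot (z * e) (y * e)). Qed.
Lemma sum_qdot_ll (z y : quat R) :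
  \sum_(c < 4) qdot (qunit R c * z) (qunit R c * y) = 4 * qdot z y.
Proof. qsum (fun e => qdot (e * z) (e * y)). Qed.
Lemma sum_qdot_rl (z y : quat R) :
  \sum_(c < 4) qdot (z * qunit R c) (qunit R c * y) = 4 * (qre z * qre y).
Proof. qsum (fun e => qdot (z * e) (e * y)). Qed.
Lemma sum_qdot_crr (z y : quat R) :
  \sum_(c < 4) qdot (z * qconj (qunit R c)) (y * qunit R c) = - 2 * qdot z y.
Proof. qsum (fun e => qdot (z * qconj e) (y * e)). Qed.
Lemma sum_qdot_cll (z y : quat R) :
  \sum_(c < 4) qdot (qconj (qunit R c) * z) (qunit R c * y) = - 2 * qdot z y.
Proof. qsum (fun e => qdot (qconj e * z) (e * y)). Qed.
Lemma sum_qdot_crl (z y : quat R) :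
  \sum_(c < 4) qdot (z * qconj (qunit R c)) (qunit R c * y) = - 2 * qdot z (qconj y).
Proof. qsum (fun e => qdot (z * qconj e) (e * y)). Qed.
Lemma sum_qdot_clr (z y : quat R) :
  \sum_(c < 4) qdot (qconj (qunit R c) * z) (y * qunit R c) = - 2 * qdot z (qconj y).
Proof. qsum (fun e => qdot (qconj e * z) (y * e)). Qed.

Lemma qre_skew X i : qadj X = - X -> qre (X i i) = 0.
Proof.
move=> eX; have := congr1 (@qre R) (skewE i i eX); rewrite !qcE.
by move=> h; lra.
Qed.

Section SkewPair.
Variables (Y Z : M) (q : 'I_n -> 'I_n -> R).
Hypotheses (eY : qadj Y = - Y) (eZ : qadj Z = - Z).
Let d a b := qdot (Z a b) (Y a b).

(** The mixed row-column terms contract to real parts of diagonal entries, which vanish for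
    skew-Hermitian matrices. *)
Lemma sum_mdot_mxbr i j :
  \sum_c mdot (smx q (mxbr Z (qE i j (qunit R c)))) (mxbr Y (qE i j (qunit R c))) =
  4 * (\sum_a q a j * d a i + \sum_b q i b * d j b).
Proof.
under eq_bigr => c _ do rewrite mdot_mxbr_qE !eqxx.
rewrite !big_split /= !sumrN -!mulr_sumr.
rewrite sum_qdot_rl (_ : \sum_(c < 4) qdot (qunit R c * _) _ =
   \sum_(c < 4) qdot (Y i i * qunit R c) (qunit R c * Z j j)); last first.
  by apply: eq_bigr => c _; rewrite qdotC.
rewrite sum_qdot_rl (qre_skew i eY) (qre_skew i eZ).
rewrite [in X in _ - X - _]mul0r.
rewrite [in X in _ - _ - X]mul0r.
rewrite [in X in _ - X - _]mulr0.
rewrite [in X in _ - _ - X]mulr0.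
rewrite [in X in _ - X - _]mulr0.
rewrite [in X in _ - _ - X]mulr0.
rewrite subr0.
rewrite subr0.
rewrite mulrDr.
congr (_ + _).
  rewrite exchange_big mulr_sumr; apply: eq_bigr => a _ /=.
  rewrite -mulr_sumr.
  rewrite sum_qdot_rr.
  by rewrite /d mulrCA.
rewrite exchange_big mulr_sumr; apply: eq_bigr => a _ /=.
rewrite -mulr_sumr.
rewrite sum_qdot_ll.
by rewrite /d mulrCA.
Qed.

(** Against the adjoint unit, which sits at (j, i), the mixed terms survive, while column-column and
    row-row terms need i = j. *)
Lemma sum_mdot_mxbr_adj i j :
  \sum_c mdot (smx q (mxbr Z (qadj (qE i j (qunit R c)))))
    (mxbr Y (qE i j (qunit R c))) =
  - 2 * (q i i + q j j) * d i j
  - 2 * (if i == j then \sum_a (q a i + q i a) * d a i else 0).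
Proof.
have dC a b : d a b = d b a.
  by rewrite /d (skewE _ _ eY) (skewE _ _ eZ) qdotNl qdotNr opprK qdot_conj.
under eq_bigr => c _ do rewrite qadj_qE mdot_mxbr_qE (eq_sym j i).
rewrite !big_split /= !sumrN -!mulr_sumr sum_qdot_crl sum_qdot_clr.
rewrite (skewE _ _ eY) qconjN qconjK qdotNr -/(d i j).
case: eqP => [<-|_]; last by rewrite !big1 //; ring.
rewrite [X in X - _ - _ + _]exchange_big [X in _ - _ - _ + X]exchange_big /=.
rewrite [X in X - _ - _ + _](eq_bigr (fun a => -2 * (q a i * d a i))); last first.
  by move=> a _; rewrite -mulr_sumr sum_qdot_crr /d mulrCA.
rewrite [X in _ - _ - _ + X](eq_bigr (fun a => -2 * (q i a * d a i))); last first.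
  by move=> a _; rewrite -mulr_sumr sum_qdot_cll -/(d i a) (dC i a) mulrCA.
rewrite -!mulr_sumr.
rewrite [in RHS](eq_bigr (fun a => q a i * d a i + q i a * d a i)); last first.
  by move=> a _; rewrite mulrDl.
by rewrite big_split /=; ring.
Qed.

End SkewPair.

(* The trace over sp(n) of a map given on all matrices: (E - qadj E) / 2 is the projection
   to sp(n) of a matrix unit E. *)
Definition mtr (F : M -> M) : R := 2^-1 * \sum_i \sum_j \sum_c
  mdot (F (qE i j (qunit R c) - qadj (qE i j (qunit R c)))) (qE i j (qunit R c)).

Lemma mtrD F G : mtr (fun x => F x + G x) = mtr F + mtr G.
Proof.
rewrite /mtr -mulrDr; congr (_ * _).
do 3 (rewrite -big_split; apply: eq_bigr => ? _ /=).
by rewrite mdotDl.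
Qed.
Lemma mtrN F : mtr (fun x => - F x) = - mtr F.
Proof.
rewrite /mtr -mulrN; congr (_ * _).
do 3 (rewrite -sumrN; apply: eq_bigr => ? _ /=).
by rewrite mdotNl.
Qed.
Lemma mtr_scale a F : mtr (fun x => smx (fun _ _ => a) (F x)) = a * mtr F.
Proof.
rewrite /mtr mulrCA; congr (_ * _).
do 3 (rewrite mulr_sumr; apply: eq_bigr => ? _ /=).
by rewrite !mdot_qE smxE qdotZl.
Qed.
End Trace.

Section TraceFormulas.
Variables (R : realType) (n : nat).
Local Notation M := 'M[quat R]_n.
Implicit Types (X Y Z A : M) (p q s : 'I_n -> 'I_n -> R).

Lemma mxbr_scale (a : R) X Y :
  mxbr X (smx (fun _ _ => a) Y) = smx (fun _ _ => a) (mxbr X Y).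
Proof.
apply/matrixP => i j; rewrite smxE !mxbrE !mxE scalerBr !scaler_sumr.
congr (_ - _); apply: eq_bigr => k _.
  by rewrite smxE scalerqAr.
by rewrite smxE scalerqAl.
Qed.

Lemma mxbr_scalel (a : R) X Y :
  mxbr (smx (fun _ _ => a) X) Y = smx (fun _ _ => a) (mxbr X Y).
Proof. by rewrite mxbrC mxbr_scale -smxN -mxbrC. Qed.

Lemma mdot_scale (a : R) X Y : mdot (smx (fun _ _ => a) X) Y = a * mdot X Y.
Proof.
rewrite !mdotE mulr_sumr; apply: eq_bigr => i _; rewrite mulr_sumr.
by apply: eq_bigr => j _; rewrite smxE qdotZl.
Qed.

Lemma smx_scale p (a : R) X : smx p (smx (fun _ _ => a) X) = smx (fun _ _ => a) (smx p X).
Proof. by rewrite !smx_comp; apply/matrixP => i j; rewrite !(smxE, mxE) mulrC. Qed.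

Lemma smx_skew_qE p i j e : (forall i j, p i j = p j i) ->
  smx p (qE i j e - qadj (qE i j e)) =
  smx (fun _ _ => p i j) (qE i j e - qadj (qE i j e)).
Proof.
move=> pC; rewrite !smxD !smxN -!qadj_smx //.
by rewrite qE_smx.
Qed.

(** Diagonal operators are self-adjoint and have both [qE i j e] and its skew part as eigenvectors,
    so [p] and [r] turn into scalars. *)
Lemma mdot_ad_qE p r X V i j e : qadj X = - X -> (forall i j, r i j = r j i) ->
  mdot (smx p (mxbr X (V (smx r (qE i j e - qadj (qE i j e)))))) (qE i j e) =
  - (p i j * mdot (V (smx (fun _ _ => r i j) (qE i j e - qadj (qE i j e))))
       (mxbr X (qE i j e))).
Proof.
move=> eX rC.
rewrite mdot_smxl qE_smx mdot_brl // mxbr_scale smx_skew_qE //.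
by rewrite mdotC mdot_scale mdotC.
Qed.

Lemma qdot_mxbr_qE X i j e : qdot (mxbr X (qE i j e) j i) (qconj e) = 0.
Proof.
rewrite qE_mxbr (eq_sym j i).
case: eqP => [->|_]; last by rewrite subr0 qdot0l.
by rewrite /qdot !qcE; ring.
Qed.

(** Once the weights are scalars on each unit, what remains are the diagonal coefficients of the
    skew operator ad X, which are zero. *)
Lemma mtr_ad1 p r X : qadj X = - X -> (forall i j, r i j = r j i) ->
  mtr (fun x => smx p (mxbr X (smx r x))) = 0.
Proof.
move=> eX rC; rewrite /mtr big1 ?mulr0 // => i _; rewrite big1 // => j _.
rewrite big1 // => c _; rewrite (mdot_ad_qE p id _ _ _ eX rC) mdot_scale.
rewrite mdotBl (_ : mdot _ _ = 0); last first.
  have := mdot_brl (qE i j (qunit R c)) (qE i j (qunit R c)) eX.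
  by rewrite mdotC => h; lra.
rewrite (_ : mdot (qadj _) _ = 0) ?subr0 ?mulr0 ?oppr0 //.
by rewrite qadj_qE mdotC mdot_qE qdot_mxbr_qE.
Qed.

(** The trace from which the whole Ricci tensor is assembled. Only the product of [p] and [r]
    enters, because both act on a unit at (i, j) by scalars. *)
Lemma mtr_ad2 p q r X Y : qadj X = - X -> qadj Y = - Y ->
  (forall i j, p i j = p j i) -> (forall i j, q i j = q j i) ->
  (forall i j, r i j = r j i) ->
  let w i j := p i j * r i j in
  mtr (fun x => smx p (mxbr X (smx q (mxbr Y (smx r x))))) =
  - \sum_i \sum_m (2 * (\sum_j (w i j * q m j + w m j * q i j))
       + (w i i + w m m) * q i m + w i m * (q i i + q m m)) * qdot (X i m) (Y i m).
Proof.
move=> eX eY pC qC rC w.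
have wC i j : w i j = w j i by rewrite /w pC rC.
pose d a b := qdot (Y a b) (X a b).
have dE a b : qdot (X a b) (Y a b) = d a b by rewrite qdotC.
have dC a b : d a b = d b a.
  by rewrite /d (skewE _ _ eY) (skewE _ _ eX) qdotNl qdotNr opprK qdot_conj.
rewrite /mtr.
(* The two summands come from the parts E and - E^* of the test element E - E^*. *)
transitivity (2^-1 * \sum_i \sum_j - (w i j * 
    (4 * (\sum_a q a j * d a i + \sum_b q i b * d j b) -
    (- 2 * (q i i + q j j) * d i j
      - 2 * (if i == j then \sum_a (q a i + q i a) * d a i else 0))))).
  congr (_ * _); apply: eq_bigr => i _; apply: eq_bigr => j _.
  rewrite -sum_mdot_mxbr // -sum_mdot_mxbr_adj // -sumrB mulr_sumr -sumrN.
  apply: eq_bigr => c _.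
  rewrite (mdot_ad_qE p (fun v => smx q (mxbr Y v)) _ _ _ eX rC) mxbr_scale.
  rewrite smx_scale mdot_scale mulrA -/(w i j) mxbrDr smxD mdotDl.
  by rewrite mxbrNr smxN mdotNl.
have S1 : \sum_i \sum_j w i j * \sum_a q a j * d a i =
    \sum_i \sum_m (\sum_j w i j * q m j) * d i m.
  apply: eq_bigr => i _.
  under eq_bigr => j _ do rewrite mulr_sumr.
  rewrite exchange_big; apply: eq_bigr => m _ /=.
  by rewrite mulr_suml; apply: eq_bigr => j _; rewrite mulrA dC.
have S1' : \sum_i \sum_m (\sum_j w i j * q m j) * d i m =
    \sum_i \sum_m (\sum_j w m j * q i j) * d i m.
  rewrite exchange_big; apply: eq_bigr => i _; apply: eq_bigr => j _.
  by rewrite dC.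
have S2 : \sum_i \sum_j w i j * \sum_b q i b * d j b =
    \sum_i \sum_m (\sum_j w i j * q m j) * d i m.
  rewrite exchange_big; apply: eq_bigr => j _ /=.
  under eq_bigr => i _ do rewrite mulr_sumr.
  rewrite exchange_big; apply: eq_bigr => m _ /=.
  by rewrite mulr_suml; apply: eq_bigr => i _; rewrite mulrA (wC i) (qC i).
have S4 : \sum_i \sum_j w i j *
      (if i == j then \sum_a (q a i + q i a) * d a i else 0) =
    \sum_i \sum_m (w i i + w m m) * q i m * d i m.
  transitivity (\sum_i \sum_m (w i i * q i m * d i m + w i i * q i m * d i m)).
    apply: eq_bigr => i _.
    transitivity (\sum_j if j == i then w i i * \sum_a (q a i + q i a) * d a i else 0).
      apply: eq_bigr => j _; rewrite (eq_sym i j); case: eqP => [->|_] //.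
      exact: mulr0.
    rewrite sum_if.
    rewrite mulr_sumr; apply: eq_bigr => a _.
    by rewrite (qC a) (dC a); ring.
  transitivity (\sum_i \sum_m w i i * q i m * d i m +
      \sum_i \sum_m w i i * q i m * d i m).
    rewrite -big_split; apply: eq_bigr => i _ /=.
    by rewrite -big_split.
  transitivity (\sum_i \sum_m w i i * q i m * d i m +
      \sum_i \sum_m w m m * q i m * d i m); last first.
    rewrite -big_split; apply: eq_bigr => i _ /=.
    by rewrite -big_split; apply: eq_bigr => m _ /=; ring.
  congr (_ + _).
  rewrite exchange_big; apply: eq_bigr => m _; apply: eq_bigr => i _ /=.
  by rewrite (qC i) (dC i).
have -> : \sum_i \sum_j - (w i j * 
    (4 * (\sum_a q a j * d a i + \sum_b q i b * d j b) -
    (- 2 * (q i i + q j j) * d i j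
      - 2 * (if i == j then \sum_a (q a i + q i a) * d a i else 0)))) =
  - (4 * (\sum_i \sum_j w i j * \sum_a q a j * d a i) +
     4 * (\sum_i \sum_j w i j * \sum_b q i b * d j b) +
     2 * (\sum_i \sum_j w i j * (q i i + q j j) * d i j) +
     2 * (\sum_i \sum_j w i j *
      (if i == j then \sum_a (q a i + q i a) * d a i else 0))).
  rewrite !mulr_sumr -!big_split /= -sumrN; apply: eq_bigr => i _.
  rewrite !mulr_sumr -!big_split /= -sumrN; apply: eq_bigr => j _.
  by ring.
rewrite S2 S1 S4 mulrN; congr (- _).
(* Of the four copies of the first sum, two are transposed by [S1'], which gives a coefficient
   symmetric in i and m. *)
transitivity (\sum_i \sum_m (\sum_j w i j * q m j) * d i m +
  \sum_i \sum_m (\sum_j w i j * q m j) * d i m + 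
  (\sum_i \sum_m (\sum_j w i j * q m j) * d i m +
  \sum_i \sum_m (\sum_j w i j * q m j) * d i m + 
  \sum_i \sum_j w i j * (q i i + q j j) * d i j +
  \sum_i \sum_m (w i i + w m m) * q i m * d i m)).
  move: (\sum_i \sum_m (\sum_j w i j * q m j) * d i m) => a1.
  move: (\sum_i \sum_j w i j * (q i i + q j j) * d i j) => a2.
  move: (\sum_i \sum_m (w i i + w m m) * q i m * d i m) => a3.
  by field.
rewrite [X in X + _ + (_ + _)]S1' [X in _ + (X + _ + _ + _)]S1'.
rewrite -!big_split; apply: eq_bigr => i _.
rewrite -!big_split; apply: eq_bigr => m _ /=.
by rewrite dE big_split /=; ring.
Qed.
End TraceFormulas.

(** * Traces of endomorphisms of sp(n) *)

Section SpTrace.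
Variables (R : realType) (n : nat).
Local Notation M := 'M[quat R]_n.
Local Notation g := (sp R n).
Implicit Types (x y z : g) (X Y : M).

Definition mat x : M := vsval x.

Lemma qadj_mat x : qadj (mat x) = - mat x.
Proof. by apply/mem_sp; exact: subvsP. Qed.

Lemma mat_inj : injective mat.
Proof. exact: val_inj. Qed.

Definition mksp X : g := vsproj (sp_space R n) (X : qmx R n).

Lemma mat_mksp X : qadj X = - X -> mat (mksp X) = X.
Proof. by move=> eX; rewrite /mat /mksp vsprojK //; apply/mem_sp. Qed.

Lemma matD x y : mat (x + y) = mat x + mat y.
Proof. exact: (linearD (@vsval R (qmx R n) (sp_space R n))). Qed.
Lemma mat0 : mat 0 = 0.
Proof. exact: (linear0 (@vsval R (qmx R n) (sp_space R n))). Qed.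
Lemma matN x : mat (- x) = - mat x.
Proof. exact: (linearN (@vsval R (qmx R n) (sp_space R n))). Qed.
Lemma matB x y : mat (x - y) = mat x - mat y.
Proof. by rewrite matD matN. Qed.
Lemma matZ a x : mat (a *: x) = smx (fun _ _ => a) (mat x).
Proof.
transitivity (a *: (mat x : qmx R n)).
  exact: (linearZZ (@vsval R (qmx R n) (sp_space R n))).
by apply/matrixP => i j; rewrite !(smxE, mxE).
Qed.
Lemma mat_br x y : mat (sp_br x y) = mxbr (mat x) (mat y).
Proof. rewrite mxbrE; exact: val_sp_br. Qed.

Lemma mat_Ad h x : mat (Ad h x) = h *m mat x *m qadj h.
Proof. exact: val_Ad. Qed.

Definition ev i j c x : R := qcoord (mat x i j) c.
Lemma evD i j c x y : ev i j c (x + y) = ev i j c x + ev i j c y.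
Proof. by rewrite /ev matD mxE qcoordD. Qed.
Lemma evZ i j c a x : ev i j c (a *: x) = a * ev i j c x.
Proof. by rewrite /ev matZ smxE qcoordZ. Qed.
Lemma ev0 i j c : ev i j c 0 = 0.
Proof. by rewrite /ev mat0 mxE qcoord0. Qed.
Lemma ev_sum i j c I (r : seq I) (P : pred I) (F : I -> g) :
  ev i j c (\sum_(k <- r | P k) F k) = \sum_(k <- r | P k) ev i j c (F k).
Proof. exact: (big_morph (ev i j c) (evD i j c) (ev0 i j c)). Qed.

(** The skew-Hermitian part of a matrix unit. These elements span sp(n) without being a basis. *)
Definition spE i j c : g :=
  mksp (smx (fun _ _ => 2^-1) (qE i j (qunit R c) - qadj (qE i j (qunit R c)))).

Lemma mat_spE i j c : mat (spE i j c) =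
  smx (fun _ _ => 2^-1) (qE i j (qunit R c) - qadj (qE i j (qunit R c))).
Proof.
by rewrite mat_mksp // qadj_smx // qadjD qadjN qadjK -smxN opprD opprK addrC.
Qed.

Lemma mat_sum I (r : seq I) (P : pred I) (F : I -> g) :
  mat (\sum_(k <- r | P k) F k) = \sum_(k <- r | P k) mat (F k).
Proof. exact: (big_morph mat matD mat0). Qed.

Lemma smx_sum s I (r : seq I) (P : pred I) (F : I -> M) :
  smx s (\sum_(k <- r | P k) F k) = \sum_(k <- r | P k) smx s (F k).
Proof. exact: (big_morph (smx s) (smxD s) (smx0 s)). Qed.

Lemma qadj0 : qadj (0 : M) = 0.
Proof. by apply/matrixP => i j; rewrite !(smxE, mxE) qconj0. Qed.

Lemma qadj_sum I (r : seq I) (P : pred I) (F : I -> M) :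
  qadj (\sum_(k <- r | P k) F k) = \sum_(k <- r | P k) qadj (F k).
Proof. exact: (big_morph (fun X : M => qadj X) (@qadjD R n) qadj0). Qed.

Lemma sp_unit x : x = \sum_i \sum_j \sum_c ev i j c x *: spE i j c.
Proof.
apply: mat_inj; rewrite mat_sum.
transitivity (smx (fun _ _ => 2^-1) (mat x - qadj (mat x))).
  rewrite qadj_mat opprK; apply/matrixP => i j; rewrite !(smxE, mxE).
  by apply: quatP; rewrite !qcE; split; field.
rewrite {1 2}(mx_unit (mat x)) qadj_sum -sumrB smx_sum; apply: eq_bigr => i _.
rewrite mat_sum qadj_sum -sumrB smx_sum; apply: eq_bigr => j _.
rewrite mat_sum qadj_sum -sumrB smx_sum; apply: eq_bigr => c _.
rewrite matZ mat_spE qadj_smx // -smxN -smxD smx_scale.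
by [].
Qed.

Lemma linear_spE (f : g -> R) :
  (forall x y, f (x + y) = f x + f y) -> (forall a x, f (a *: x) = a * f x) ->
  forall x, f x = \sum_i \sum_j \sum_c ev i j c x * f (spE i j c).
Proof.
move=> fD fZ x.
have f0 : f 0 = 0 by rewrite -(scale0r (0 : g)) fZ mul0r.
rewrite {1}(sp_unit x) (big_morph f fD f0); apply: eq_bigr => i _.
rewrite (big_morph f fD f0); apply: eq_bigr => j _.
by rewrite (big_morph f fD f0); apply: eq_bigr => c _; rewrite fZ.
Qed.

(** A basis can be replaced by the spanning family: since x is the sum of the ev(x) spE, the trace
    of f is the sum of the ev(f(spE)), whichever basis defines [lin_trace]. *)
Lemma lin_trace_mtr (f : g -> g) (F : M -> M) :
  (forall x y, f (x + y) = f x + f y) -> (forall a x, f (a *: x) = a *: f x) ->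
  (forall x, mat (f x) = F (mat x)) -> lin_trace f = mtr F.
Proof.
move=> fD fZ fF; rewrite /lin_trace.
set b := vbasis _.
have f0 : f 0 = 0 by have := fZ 0 0; rewrite !scale0r.
transitivity (\sum_i \sum_j \sum_c ev i j c (f (spE i j c))).
  rewrite (eq_bigr (fun m : 'I_(\dim {:g}) => \sum_i \sum_j \sum_c
     ev i j c (f b`_m) * coord b m (spE i j c))); last first.
    move=> m _; apply: linear_spE => [x y|a x]; by rewrite ?linearD ?linearZ.
  rewrite exchange_big; apply: eq_bigr => i _ /=.
  rewrite exchange_big; apply: eq_bigr => j _ /=.
  rewrite exchange_big; apply: eq_bigr => c _ /=.
  rewrite {2}(coord_vbasis (memvf (spE i j c))).
  rewrite (big_morph f fD f0) ev_sum; apply: eq_bigr => m _.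
  by rewrite fZ evZ mulrC.
rewrite /mtr !mulr_sumr; apply: eq_bigr => i _.
rewrite !mulr_sumr; apply: eq_bigr => j _.
rewrite !mulr_sumr; apply: eq_bigr => c _.
have eE : mat (2 *: spE i j c) = qE i j (qunit R c) - qadj (qE i j (qunit R c)).
  rewrite matZ mat_spE smx_comp; apply/matrixP => a b'; rewrite !(smxE, mxE).
  by rewrite mulfV ?pnatr_eq0 // scale1r.
rewrite -eE -fF fZ matZ mdot_scale mulrA mulVf ?pnatr_eq0 // mul1r.
by rewrite mdot_qE qdot_unit.
Qed.

End SpTrace.

(** * The Ricci tensor of a diagonal metric *)

Lemma addsubACA (V : zmodType) (a a' b b' c c' : V) :
  (a + a') + (b + b') - (c + c') = (a + b - c) + (a' + b' - c').
Proof. by rewrite opprD [X in X + _ = _]addrACA (addrACA (a + b)). Qed.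

Lemma subaddACA (V : zmodType) (a a' b b' c c' : V) :
  - (a + a') - (b + b') + (c + c') = (- a - b + c) + (- a' - b' + c').
Proof. by rewrite !opprD [X in X + _ = _]addrACA (addrACA (- a - b)). Qed.

Fact Dm_key : unit. Proof. by []. Qed.

Section DiagonalMetric.
Variables (R : realType) (n : nat).
Local Notation M := 'M[quat R]_n.
Local Notation g := (sp R n).
Implicit Types (x y z : g) (X Y Z A B V W : M) (p q r a b : 'I_n -> 'I_n -> R).

Variable s : 'I_n -> 'I_n -> R.
Hypotheses (sC : forall i j, s i j = s j i) (s_gt0 : forall i j, 0 < s i j).

Definition dip x y : R := mdot (smx s (mat x)) (mat y).

Lemma dipC x y : dip x y = dip y x.
Proof. by rewrite /dip mdot_smxl mdotC. Qed.

Lemma dip_inner : inner_product dip.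
Proof.
split; first exact: dipC.
- by move=> a x y z; rewrite /dip matD matZ smxD mdotDl smx_scale mdot_scale.
move=> x; apply: contra_neqT; rewrite -leNgt => h; apply: mat_inj; rewrite mat0.
have ge i j : 0 <= qdot (smx s (mat x) i j) (mat x i j).
  by rewrite smxE qdotZl mulr_ge0 ?qdot_ge0 // ltW.
have h0 : dip x x = 0.
  apply/eqP; rewrite eq_le h /dip mdotE; apply: sumr_ge0 => i _; apply: sumr_ge0 => j _.
  exact: ge.
apply/matrixP => i j; rewrite mxE; apply: qdot_eq0.
move: h0; rewrite /dip mdotE => h0.
have h1 : \sum_j qdot (smx s (mat x) i j) (mat x i j) = 0.
  by apply: (psumr_eq0P _ h0) => // k _; exact: sumr_ge0.
have /eqP : qdot (smx s (mat x) i j) (mat x i j) = 0.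
  by apply: (psumr_eq0P _ h1).
by rewrite smxE qdotZl mulf_eq0 gt_eqF //= => /eqP.
Qed.

Let one (i j : 'I_n) : R := 1.
Let si i j : R := (s i j)^-1.
Let scl (a : R) X : M := smx (fun _ _ => a) X.

Let smx1 X : smx one X = X.
Proof. by apply/matrixP => i j; rewrite !(smxE, mxE) scale1r. Qed.

Let siC i j : si i j = si j i. Proof. by rewrite /si sC. Qed.

Let smx_si X : smx s (smx si X) = X.
Proof.
by apply/matrixP => i j; rewrite !(smxE, mxE) scalerA mulfV ?scale1r // gt_eqF.
Qed.

(** Each term of Koszul's formula is an ad operator between two diagonal ones. Composing two of them
    gives [op2], whose trace [mtr_ad2] computes. *)
Definition op p a A r X : M := smx p (mxbr (smx a A) (smx r X)).
Definition op2 p a A q b B r X : M :=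
  smx p (mxbr (smx a A) (smx q (mxbr (smx b B) (smx r X)))).

Lemma opD p a A r X Y : op p a A r (X + Y) = op p a A r X + op p a A r Y.
Proof. by rewrite /op smxD mxbrDr smxD. Qed.
Lemma opN p a A r X : op p a A r (- X) = - op p a A r X.
Proof. by rewrite /op smxN mxbrNr smxN. Qed.
Lemma op_scl p a A r c X : op p a A r (scl c X) = scl c (op p a A r X).
Proof. by rewrite /op /scl smx_scale mxbr_scale smx_scale. Qed.
Lemma op_op p a A r p' b B r' X :
  op p a A r (op p' b B r' X) = op2 p a A (fun i j => r i j * p' i j) b B r' X.
Proof. by rewrite /op /op2 smx_comp. Qed.

(* Koszul's formula; smx s is the operator Lambda with <x, y> = B (Lambda x) y. *)
Definition Dm : M -> M -> M := locked_with Dm_key (fun X Y => scl (2^-1)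
  (mxbr X Y + smx si (mxbr X (smx s Y) - mxbr (smx s X) Y))).

Lemma DmE X Y : Dm X Y =
  scl (2^-1) (mxbr X Y + smx si (mxbr X (smx s Y) - mxbr (smx s X) Y)).
Proof. by rewrite /Dm unlock. Qed.

Lemma DmE1 Y V : Dm Y V =
  scl (2^-1) (op one one Y one V + op si one Y s V - op si s Y one V).
Proof. by rewrite !DmE /op !smx1 smxD smxN addrA. Qed.

(** The same formula as an operator in the first argument, over which the Ricci trace runs. *)
Lemma DmE2 X Z : Dm X Z =
  scl (2^-1) (- op one one Z one X - op si s Z one X + op si one Z s X).
Proof.
rewrite !DmE /op !smx1 smxD smxN (mxbrC X Z) (mxbrC X (smx s Z)) smxN.
by rewrite (mxbrC (smx s X)) smxN opprK addrA.
Qed.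

Lemma scl_lin c X Y : scl c (X + Y) = scl c X + scl c Y. Proof. exact: smxD. Qed.

Lemma scl_addsub c d X Y Z : scl c (scl d X + scl d Y - scl d Z) =
  scl d (scl c (X + Y - Z)).
Proof. by rewrite /scl -smxN -!smxD smx_scale. Qed.

Lemma scl_subadd c d X Y Z : scl c (- scl d X - scl d Y + scl d Z) =
  scl d (scl c (- X - Y + Z)).
Proof. by rewrite /scl -!smxN -!smxD smx_scale. Qed.

Lemma DmDr X Y Z : Dm X (Y + Z) = Dm X Y + Dm X Z.
Proof.
rewrite !DmE1 !opD -scl_lin; congr scl.
exact: addsubACA.
Qed.
Lemma DmDl X Y Z : Dm (X + Y) Z = Dm X Z + Dm Y Z.
Proof.
rewrite !DmE2 !opD -scl_lin; congr scl.
exact: subaddACA.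
Qed.
Lemma DmZr c X Y : Dm X (scl c Y) = scl c (Dm X Y).
Proof.
by rewrite !DmE1 !op_scl; exact: scl_addsub.
Qed.
Lemma DmZl c X Y : Dm (scl c X) Y = scl c (Dm X Y).
Proof.
by rewrite !DmE2 !op_scl; exact: scl_subadd.
Qed.

Definition symmetric_fun p := forall i j, p i j = p j i.

Lemma skew_smx p X : symmetric_fun p -> qadj X = - X -> qadj (smx p X) = - smx p X.
Proof. by move=> pC eX; rewrite qadj_smx // eX smxN. Qed.

Lemma Dm_skew X Y : qadj X = - X -> qadj Y = - Y -> qadj (Dm X Y) = - Dm X Y.
Proof.
move=> eX eY.
have skewD A B : qadj A = - A -> qadj B = - B -> qadj (A + B) = - (A + B).
  by move=> eA eB; rewrite qadjD eA eB opprD.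
have skewN A : qadj A = - A -> qadj (- A) = - - A by move=> eA; rewrite qadjN eA.
rewrite DmE; apply: skew_smx => //; apply: (skewD); first exact: qadj_mxbr.
apply: skew_smx => //; apply: (skewD); last apply: (skewN).
  by apply: qadj_mxbr => //; exact: skew_smx.
by apply: qadj_mxbr => //; exact: skew_smx.
Qed.

Lemma scl_sub c X Y : scl c X - scl c Y = scl c (X - Y).
Proof. by rewrite /scl smxD smxN. Qed.

Lemma scl_half X : scl (2^-1) (X + X) = X.
Proof.
by apply/matrixP => i j; rewrite !(smxE, mxE); apply: quatP; rewrite !qcE; split; field.
Qed.

Lemma addsub_double (V : zmodType) (a b c : V) :
  (a + b - c) - (- a - c + b) = a + a.
Proof.
by rewrite -(addrA a b) -(addrA (- a)) [- c + b]addrC (opprD (- a)) opprK addrACA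
  subrr addr0.
Qed.

(** The Lambda^-1 part of Koszul's formula is symmetric in [X] and [Y] and cancels. *)
Lemma Dm_torsion X Y : Dm X Y - Dm Y X = mxbr X Y.
Proof.
rewrite (DmE1 X Y) (DmE2 Y X) scl_sub -[RHS]scl_half; congr scl.
rewrite /op !smx1; exact: addsub_double.
Qed.

Lemma mdot_smx_Dm X Y Z : mdot (smx s (Dm X Y)) Z = 2^-1 *
  (mdot (mxbr X Y) (smx s Z) + mdot (mxbr X (smx s Y)) Z
   - mdot (mxbr (smx s X) Y) Z).
Proof.
rewrite !DmE /scl smx_scale mdot_scale smxD smx_si.
by rewrite (mdotDl (smx s (mxbr X Y))) mdotBl (mdot_smxl s (mxbr X Y)) addrA.
Qed.

(** By ad-invariance of the trace form, the three terms of [mdot_smx_Dm] are together antisymmetric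
    in [Y] and [Z]. *)
Lemma Dm_metric X Y Z : qadj X = - X -> qadj Y = - Y -> qadj Z = - Z ->
  mdot (smx s (Dm X Y)) Z + mdot (smx s Y) (Dm X Z) = 0.
Proof.
move=> eX eY eZ.
have esX : qadj (smx s X) = - smx s X by rewrite qadj_smx // eX smxN.
rewrite (mdot_smxl s Y) [mdot Y _]mdotC !mdot_smx_Dm.
rewrite (mdot_brl Y (smx s Z) eX) (mdot_brl (smx s Y) Z eX) (mdot_brl Y Z esX).
rewrite [mdot (mxbr X Z) _]mdotC [mdot (mxbr X (smx s Z)) _]mdotC.
by rewrite [mdot (mxbr (smx s X) Z) _]mdotC; ring.
Qed.

Definition dcon x y : g := mksp (Dm (mat x) (mat y)).

Lemma mat_dcon x y : mat (dcon x y) = Dm (mat x) (mat y).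
Proof. by rewrite mat_mksp // Dm_skew //; exact: qadj_mat. Qed.

Lemma dcon_levi_civita : levi_civita (@sp_br R n) dip dcon.
Proof.
split.
- move=> a x y z; apply: mat_inj.
  rewrite (matD (a *: dcon x z)) (matZ a (dcon x z)) !mat_dcon (matD (a *: x)).
  by rewrite (matZ a x) DmDl; congr (_ + _); exact: DmZl.
- move=> a x y z; apply: mat_inj.
  rewrite (matD (a *: dcon x y)) (matZ a (dcon x y)) !mat_dcon (matD (a *: y)).
  by rewrite (matZ a y) DmDr; congr (_ + _); exact: DmZr.
- move=> x y; apply: mat_inj; rewrite (matB (dcon x y)) !mat_dcon mat_br.
  exact: Dm_torsion.
move=> x y z; rewrite /dip !mat_dcon.
by apply: Dm_metric; exact: qadj_mat.
Qed.

(* A quadratic form with coefficients sum_j f i m j + f0 i m: every trace in the Ricci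
   tensor has this shape, so that traces are compared one index j at a time. *)
Definition QF (f : 'I_n -> 'I_n -> 'I_n -> R) (f0 : 'I_n -> 'I_n -> R) Y Z : R :=
  \sum_i \sum_m (\sum_j f i m j + f0 i m) * qdot (Y i m) (Z i m).

Lemma QFD f f0 h h0 Y Z : QF f f0 Y Z + QF h h0 Y Z =
  QF (fun i m j => f i m j + h i m j) (fun i m => f0 i m + h0 i m) Y Z.
Proof.
rewrite /QF -big_split; apply: eq_bigr => i _ /=.
rewrite -big_split; apply: eq_bigr => m _ /=.
by rewrite -mulrDl big_split /= addrACA.
Qed.
Lemma QFZ c f f0 Y Z : c * QF f f0 Y Z =
  QF (fun i m j => c * f i m j) (fun i m => c * f0 i m) Y Z.
Proof.
rewrite /QF mulr_sumr; apply: eq_bigr => i _ /=.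
rewrite mulr_sumr; apply: eq_bigr => m _ /=.
by rewrite mulrA [c * (_ + _)]mulrDr mulr_sumr.
Qed.
Lemma QFN f f0 Y Z : - QF f f0 Y Z =
  QF (fun i m j => - f i m j) (fun i m => - f0 i m) Y Z.
Proof.
rewrite /QF -sumrN; apply: eq_bigr => i _ /=.
rewrite -sumrN; apply: eq_bigr => m _ /=.
by rewrite -mulNr opprD sumrN.
Qed.
Lemma QFC f f0 Y Z : QF f f0 Y Z = QF f f0 Z Y.
Proof. by apply: eq_bigr => i _; apply: eq_bigr => m _; rewrite qdotC. Qed.
Lemma eq_QF f f0 h h0 Y Z : (forall i m j, f i m j = h i m j) ->
  (forall i m, f0 i m = h0 i m) -> QF f f0 Y Z = QF h h0 Y Z.
Proof.
move=> e e0; apply: eq_bigr => i _; apply: eq_bigr => m _.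
by rewrite e0; congr ((_ + _) * _); apply: eq_bigr => j _.
Qed.

Lemma eq_mtr (F G : M -> M) : F =1 G -> mtr F = mtr G.
Proof.
move=> e; rewrite /mtr; congr (_ * _).
by do 3 (apply: eq_bigr => ? _); rewrite e.
Qed.

Lemma mtr_op p a A r : symmetric_fun a -> symmetric_fun r -> qadj A = - A ->
  mtr (op p a A r) = 0.
Proof. by move=> aC rC eA; apply: mtr_ad1 => //; exact: skew_smx. Qed.

Lemma mtr_op2 p a q b r Y Z : symmetric_fun p -> symmetric_fun a ->
  symmetric_fun q -> symmetric_fun b -> symmetric_fun r ->
  qadj Y = - Y -> qadj Z = - Z ->
  mtr (op2 p a Y q b Z r) =
  QF (fun i m j => - (2 * (p i j * r i j * q m j + p m j * r m j * q i j) * (a i m * b i m)))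
     (fun i m => - (((p i i * r i i + p m m * r m m) * q i m
        + p i m * r i m * (q i i + q m m)) * (a i m * b i m))) Y Z.
Proof.
move=> pC aC qC bC rC eY eZ.
rewrite [LHS](mtr_ad2 (skew_smx aC eY) (skew_smx bC eZ) pC qC rC) /QF.
rewrite -sumrN; apply: eq_bigr => i _; rewrite -sumrN; apply: eq_bigr => m _.
rewrite !smxE qdotZl qdotZr sumrN -mulr_suml -mulr_sumr.
by ring.
Qed.

Lemma Dm_Dm X Y Z : Dm Y (Dm X Z) = scl (2^-1) (scl (2^-1) (
  (- op2 one one Y (fun i j => one i j * one i j) one Z one X
   - op2 one one Y (fun i j => one i j * si i j) s Z one X
   + op2 one one Y (fun i j => one i j * si i j) one Z s X)
  + (- op2 si one Y (fun i j => s i j * one i j) one Z one X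
   - op2 si one Y (fun i j => s i j * si i j) s Z one X
   + op2 si one Y (fun i j => s i j * si i j) one Z s X)
  - (- op2 si s Y (fun i j => one i j * one i j) one Z one X
   - op2 si s Y (fun i j => one i j * si i j) s Z one X
   + op2 si s Y (fun i j => one i j * si i j) one Z s X))).
Proof.
by rewrite (DmE1 Y) DmE2 !op_scl scl_addsub !opD !opN !op_op.
Qed.

Lemma Dm_br X Y Z : Dm (mxbr X Y) Z = - scl (2^-1) (
   - op2 one one Z (fun i j => one i j * one i j) one Y one X
   - op2 si s Z (fun i j => one i j * one i j) one Y one X
   + op2 si one Z (fun i j => s i j * one i j) one Y one X).
Proof.
rewrite (mxbrC X Y) DmE2 !opN.
rewrite (_ : mxbr Y X = op one one Y one X); last by rewrite /op !smx1.
by rewrite !op_op /scl -smxN; congr smx; rewrite !opprD !opprK.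
Qed.

Lemma mtr_scl c (F : M -> M) : mtr (fun X => scl c (F X)) = c * mtr F.
Proof. exact: mtr_scale. Qed.

(* The splitting is not canonical: constants of size n are spread over the sum in j. *)
Definition ricci_coef i m j : R :=
  2 + s i m ^+ 2 / (s i j * s m j) - s i j / s m j - s m j / s i j.
Definition ricci_coef0 i m : R := 2 - (s i i + s m m) / (2 * s i m).

(** [W] stands for D_Y Z. It may be any skew matrix, since x |-> D_x W is a combination of single
    brackets, of trace zero. The other two terms are combinations of [op2]; their coefficients are
    compared as rational functions of the weights. *)
Lemma mtr_curvature Y Z W : qadj Y = - Y -> qadj Z = - Z -> qadj W = - W ->
  mtr (fun X => Dm X W - Dm Y (Dm X Z) - Dm (mxbr X Y) Z) =
  QF ricci_coef ricci_coef0 Y Z.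
Proof.
move=> eY eZ eW.
have oneC : symmetric_fun one by [].
have mulC p q : symmetric_fun p -> symmetric_fun q ->
    symmetric_fun (fun i j => p i j * q i j) by move=> pC qC i j; rewrite pC qC.
rewrite (@eq_mtr _ (fun X => scl (2^-1)
    (- op one one W one X - op si s W one X + op si one W s X) +
    - Dm Y (Dm X Z) + - Dm (mxbr X Y) Z)); last first.
  by move=> X; rewrite [Dm X W]DmE2.
rewrite !mtrD !mtrN mtr_scl !mtrD !mtrN !mtr_op // oppr0 !addr0 mulr0 add0r.
rewrite (eq_mtr (fun X => Dm_Dm X Y Z)) (eq_mtr (fun X => Dm_br X Y Z)).
rewrite mtrN !mtr_scl !(mtrD, mtrN) !mtr_op2 //; try exact: mulC.
rewrite !(QFC _ _ Z Y) !(QFD, QFN, QFZ).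
have sn0 i j : s i j != 0 by rewrite gt_eqF.
apply: eq_QF => [i m j|i m] /=; rewrite /ricci_coef /ricci_coef0 /one /si.
  by field; rewrite !sn0.
by field; rewrite !sn0.
Qed.

End DiagonalMetric.

(** * The Einstein condition and invariance for diagonal weights *)

Section EinsteinCriterion.
Variables (R : realType) (n : nat).
Local Notation M := 'M[quat R]_n.
Implicit Types (X Y Z W : M).

Lemma addsub_subACA (V : zmodType) (a a' b b' c c' : V) :
  (a + a') - (b + b') - (c + c') = (a - b - c) + (a' - b' - c').
Proof. by rewrite !opprD [X in X + _ = _]addrACA (addrACA (a - b)). Qed.

Lemma lin_trace_mtr_linear (f : sp R n -> sp R n) (F : M -> M) :
  (forall x, mat (f x) = F (mat x)) -> (forall X Y, F (X + Y) = F X + F Y) ->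
  (forall a X, F (smx (fun _ _ => a) X) = smx (fun _ _ => a) (F X)) ->
  lin_trace f = mtr F.
Proof.
move=> fF FD FZ; apply: lin_trace_mtr => //.
- by move=> x y; apply: mat_inj; rewrite fF (matD x y) FD (matD (f x)) !fF.
- by move=> a x; apply: mat_inj; rewrite fF (matZ a x) FZ (matZ a (f x)) fF.
Qed.

Variable s : 'I_n -> 'I_n -> R.
Hypotheses (sC : forall i j, s i j = s j i) (s_gt0 : forall i j, 0 < s i j).

Lemma ricci_dcon y z : ricci (@sp_br R n) (dcon s) y z =
  QF (ricci_coef s) (ricci_coef0 s) (mat y) (mat z).
Proof.
pose Y := mat y; pose Z := mat z; pose W := mat (dcon s y z).
rewrite /ricci (@lin_trace_mtr_linear _
    (fun X => Dm s X W - Dm s Y (Dm s X Z) - Dm s (mxbr X Y) Z)).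
- by rewrite (mtr_curvature sC s_gt0) //; exact: qadj_mat.
- move=> x; rewrite /curvature (matB (_ - _)) (matB (dcon s x _)).
  by rewrite /W !(mat_dcon sC) mat_br.
- by move=> X X'; rewrite mxbrDl !DmDl DmDr; exact: addsub_subACA.
move=> a X; rewrite mxbr_scalel.
rewrite (DmZl s a X W) (DmZl s a X Z) (DmZr s a Y (Dm s X Z)).
rewrite (DmZl s a (mxbr X Y) Z).
by rewrite !smxD !smxN.
Qed.

Lemma einstein_dip lambda :
  (forall i m, \sum_j ricci_coef s i m j + ricci_coef0 s i m = lambda * s i m) ->
  einstein (@sp_br R n) (dip s).
Proof.
move=> h; exists (dcon s); split; first exact: dcon_levi_civita.
exists lambda => y z; rewrite ricci_dcon /QF /dip mdotE mulr_sumr.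
apply: eq_bigr => i _; rewrite mulr_sumr; apply: eq_bigr => m _.
by rewrite h smxE qdotZl mulrA.
Qed.

(** The hypothesis says that [h] mixes only rows that carry the same weights. *)
Lemma smx_mull (h : M) X : (forall i a, h i a = 0 \/ forall j, s i j = s a j) ->
  smx s (h *m X) = h *m smx s X.
Proof.
move=> hs; apply/matrixP => i j; rewrite smxE !mxE scaler_sumr.
apply: eq_bigr => a _; rewrite smxE scalerqAr.
by case: (hs i a) => [->|->] //; rewrite !mul0r !scaler0.
Qed.

Lemma smx_mulr (h : M) X : (forall i a, h i a = 0 \/ forall j, s i j = s a j) ->
  smx s (X *m qadj h) = smx s X *m qadj h.
Proof.
move=> hs; rewrite -[LHS]qadjK qadj_smx // qadjM qadjK smx_mull //.
by rewrite qadjM qadj_smx // !qadjK.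
Qed.

Lemma Ad_invariant_dip (H : set M) : H `<=` @Sp R n ->
  (forall h, H h -> forall i a, h i a = 0 \/ forall j, s i j = s a j) ->
  Ad_invariant H (dip s).
Proof.
move=> HSp Hs h Hh x y; have hh : qadj h *m h = 1%:M by exact: HSp.
have -> : dip s (Ad h x) (Ad h y) =
    mdot (smx s (h *m mat x *m qadj h)) (h *m mat y *m qadj h).
  by rewrite /dip !mat_Ad.
rewrite (smx_mulr _ (Hs h Hh)) (smx_mull _ (Hs h Hh)).
rewrite mdot_mulr mdot_mull qadjK -!mulmxA (mulmxA (qadj h) h) hh mul1mx.
by rewrite mulmx1.
Qed.

End EinsteinCriterion.

(** * Three blocks *)

Section Blocks.
Variables (R : realType) (k l : nat).
Local Notation n := (k + k + l)%N.

Definition blk (i : 'I_n) : 'I_3 :=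
  if (i < k)%N then inord 0 else if (i < k + k)%N then inord 1 else inord 2.

Lemma blk0 (i : 'I_k) : blk (lshift l (lshift k i)) = inord 0.
Proof. by rewrite /blk /= ltn_ord. Qed.
Lemma blk1 (i : 'I_k) : blk (lshift l (rshift k i)) = inord 1.
Proof. by rewrite /blk /= ltnNge leq_addr /= ltn_add2l ltn_ord. Qed.
Lemma blk2 (i : 'I_l) : blk (rshift (k + k) i) = inord 2.
Proof.
rewrite /blk /= [(_ < k + k)%N]ltnNge leq_addr /= ltnNge.
by rewrite -addnA leq_addr.
Qed.

Variables u v y : R.

(* u: both sp(k) blocks; v: sp(l); y: the part between the two sp(k) blocks. *)
Definition bw (a b : 'I_3) : R :=
  if a == b then if a == inord 2 then v else u
  else if (a == inord 2) || (b == inord 2) then 1 else y.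

Definition bs (i j : 'I_n) : R := bw (blk i) (blk j).

Lemma bwC a b : bw a b = bw b a.
Proof. by rewrite /bw eq_sym orbC; case: eqP => [->|]. Qed.

Lemma bsC i j : bs i j = bs j i. Proof. exact: bwC. Qed.

Lemma bs_gt0 : 0 < u -> 0 < v -> 0 < y -> forall i j, 0 < bs i j.
Proof. by move=> u0 v0 y0 i j; rewrite /bs /bw; do ! case: ifP => _. Qed.

Lemma bw_cases a : [\/ a = inord 0 :> 'I_3, a = inord 1 :> 'I_3 | a = inord 2 :> 'I_3].
Proof.
case: a => [[|[|[|//]]]] lt_a; [apply: Or31|apply: Or32|apply: Or33];
  by apply: val_inj; rewrite /= inordK.
Qed.

Lemma inord3E (a b : nat) : (a < 3)%N -> (b < 3)%N ->
  ((inord a : 'I_3) == inord b) = (a == b).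
Proof. by move=> ha hb; rewrite -val_eqE /= !inordK. Qed.

Lemma sum_blk (F : 'I_3 -> R) : \sum_i F (blk i) =
  k%:R * F (inord 0) + k%:R * F (inord 1) + l%:R * F (inord 2).
Proof.
rewrite !big_split_ord /=.
under eq_bigr => i _ do rewrite blk0.
under [X in _ + X + _]eq_bigr => i _ do rewrite blk1.
under [X in _ + X]eq_bigr => i _ do rewrite blk2.
by rewrite !sumr_const !card_ord !mulr_natl.
Qed.

(** The four equations belong to the pairs of blocks (1,1), (3,3), (1,2) and (1,3); the remaining
    pairs repeat them by symmetry. In the last one the weight is 1, so its left side is lambda
    itself. *)
Lemma einstein_blocks lambda : 0 < u -> 0 < v -> 0 < y ->
  let K : R := k%:R in let L : R := l%:R in
  K + 1 + K * (u ^+ 2 / y ^+ 2) + L * u ^+ 2 = lambda * u ->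
  L + 1 + 2 * K * v ^+ 2 = lambda * v ->
  4 * K + 2 - (2 * K + 1) * (u / y) + L * y ^+ 2 = lambda * y ->
  4 * K + 2 * L + 2 - K * (u + y) - L * v - (u + v) / 2 = lambda ->
  einstein (@sp_br R n) (dip bs).
Proof.
move=> u0 v0 y0 K L E1 E2 E3 E4.
apply: (@einstein_dip _ _ _ bsC (bs_gt0 u0 v0 y0) lambda) => i m.
rewrite /ricci_coef /ricci_coef0 /bs.
rewrite (sum_blk (fun b => 2 + bw (blk i) (blk m) ^+ 2 /
  (bw (blk i) b * bw (blk m) b) - bw (blk i) b / bw (blk m) b
   - bw (blk m) b / bw (blk i) b)).
rewrite -/K -/L.
have un : u != 0 by rewrite gt_eqF.
have vn : v != 0 by rewrite gt_eqF.
have yn : y != 0 by rewrite gt_eqF.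
by case: (bw_cases (blk i)) => ->; case: (bw_cases (blk m)) => ->;
  rewrite /bw !inord3E //= -?E1 -?E2 -?E3 ?mulr1 -?E4; field; rewrite ?un ?vn ?yn.
Qed.

Lemma qadj_block m1 m2 n1 n2 (A : 'M[quat R]_(m1, n1)) (B : 'M[quat R]_(m1, n2))
    (C : 'M[quat R]_(m2, n1)) (D : 'M[quat R]_(m2, n2)) :
  qadj (block_mx A B C D) = block_mx (qadj A) (qadj C) (qadj B) (qadj D).
Proof. by rewrite /qadj map_block_mx tr_block_mx. Qed.

Lemma qadj_zero m1 m2 : qadj (0 : 'M[quat R]_(m1, m2)) = 0.
Proof. by apply/matrixP => i j; rewrite !mxE qconj0. Qed.

Lemma Sp_block_diag m1 m2 (A : 'M[quat R]_m1) (B : 'M[quat R]_m2) :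
  Sp A -> Sp B -> Sp (block_mx A 0 0 B).
Proof.
rewrite /Sp /= => eA eB; rewrite qadj_block !qadj_zero mulmx_block.
by rewrite !mul0mx !mulmx0 !addr0 add0r eA eB -scalar_mx_block.
Qed.

Lemma Ad_invariant_blocks : Ad_invariant (block_Sp R k k l) (dip bs).
Proof.
apply: Ad_invariant_dip; first exact: bsC.
  move=> h [a [b [c [ha hb hc ->]]]].
  by apply: Sp_block_diag => //; exact: Sp_block_diag.
move=> h [a [b [c [_ _ _ ->]]]] i m.
case: (split_ordP i) => i' ->; case: (split_ordP m) => m' ->.
- case: (split_ordP i') => i'' ->; case: (split_ordP m') => m'' ->.
  + by right => j; rewrite /bs !blk0.
  + by left; rewrite block_mxEul block_mxEur mxE.
  + by left; rewrite block_mxEul block_mxEdl mxE.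
  + by right => j; rewrite /bs !blk1.
- by left; rewrite block_mxEur mxE.
- by left; rewrite block_mxEdl mxE.
- by right => j; rewrite /bs !blk2.
Qed.

End Blocks.

(** * Positive solutions of the reduced Einstein equations *)

Section Solutions.
Variables (R : rcfType) (k l : R).
Hypotheses (k_gt0 : 0 < k) (lt_kl : k < l).

Local Ltac klra := have := k_gt0; have := lt_kl; lra.

(* Normalising the weights by w13 = w23 = 1, the Einstein equations without the
   solutions u = y give u = (k + 1) y / sD y, lambda = sW y / (y sD y) and
   v = sV y / ((2 l + 1) y sD y), with sP y = 0 as remaining equation. *)
Definition sD (y : R) := 3 * k + 1 + l * y ^+ 2.
Definition sW (y : R) := sD y ^+ 2 + (k + 1) * (k + l * y ^+ 2).
Definition sV (y : R) := 2 * (4 * k + 2 * l + 2 - k * y) * (y * sD y)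
  - 2 * sW y - (2 * k + 1) * (k + 1) * y ^+ 2.
Definition sP (y : R) := 2 * k * sV y ^+ 2 - (2 * l + 1) * sW y * sV y
  + (l + 1) * (2 * l + 1) ^+ 2 * (y * sD y) ^+ 2.

(** [sP] as a formal polynomial, to which the intermediate value theorem [poly_ivt] applies over any
    real closed field. *)
Definition sP_poly : {poly R} :=
  let D : {poly R} := (3 * k + 1)%:P + l%:P * 'X ^+ 2 in
  let W : {poly R} := D ^+ 2 + (k + 1)%:P * (k%:P + l%:P * 'X ^+ 2) in
  let V : {poly R} := 2%:P * ((4 * k + 2 * l + 2)%:P - k%:P * 'X) * ('X * D)
   - 2%:P * W - ((2 * k + 1) * (k + 1))%:P * 'X ^+ 2 in
  (2 * k)%:P * V ^+ 2 - (2 * l + 1)%:P * W * V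
  + ((l + 1) * (2 * l + 1) ^+ 2)%:P * ('X * D) ^+ 2.

Lemma horner_sP y : sP_poly.[y] = sP y.
Proof. by rewrite /sP_poly !(hornerD, hornerN, hornerM, horner_exp, hornerX, hornerC). Qed.

Lemma lsqr_ge0 y : 0 <= l * y ^+ 2.
Proof. by rewrite mulr_ge0 ?sqr_ge0 // ltW // (lt_trans k_gt0). Qed.

Lemma sD_gt0 y : 0 < sD y.
Proof.
have h := lsqr_ge0 y.
by rewrite /sD; klra.
Qed.

Lemma sW_gt0 y : 0 < sW y.
Proof.
rewrite /sW; apply: ltr_pwDl; first exact: exprn_gt0 (sD_gt0 y).
by have h := lsqr_ge0 y; apply: mulr_ge0; klra.
Qed.

(** If [sV y] is not positive, no term of [sP y] is negative, and the last one is positive. *)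
Lemma sP_gt0 y : 0 < y -> sV y <= 0 -> 0 < sP y.
Proof.
move=> y0 V0; rewrite /sP; apply: ltr_wpDl; last first.
  apply: mulr_gt0; last by rewrite exprn_gt0 // mulr_gt0 // sD_gt0.
  by apply: mulr_gt0; [klra|apply: exprn_gt0; klra].
have h : 0 <= (2 * l + 1) * - (sW y * sV y).
  by rewrite -mulrN !mulr_ge0 ?oppr_ge0 ?(ltW (sW_gt0 y)) //; klra.
have h2 : 0 <= k * sV y ^+ 2 by rewrite mulr_ge0 ?sqr_ge0 // ltW.
by rewrite -2!mulrA -mulrN addr_ge0 // mulr_ge0.
Qed.

(** The hypothesis bounds (4k + 2l + 2) y D by D^2, which the part D^2 of W absorbs; all other terms
    of V are nonpositive. *)
Lemma sV_le0 y : 0 < y -> (4 * k + 2 * l + 2) * y <= sD y -> sV y <= 0.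
Proof.
move=> y0 h; rewrite /sV.
have D0 := sD_gt0 y.
have h1 : (4 * k + 2 * l + 2) * y * sD y <= sD y * sD y by rewrite ler_pM2r.
have h2 : 0 <= k * y * (y * sD y) by rewrite !mulr_ge0 // ltW.
have h3 : 0 <= (k + 1) * (k + l * y ^+ 2) by have hl := lsqr_ge0 y; apply: mulr_ge0; klra.
have h4 : 0 <= (2 * k + 1) * (k + 1) * y ^+ 2.
  by apply: mulr_ge0; [apply: mulr_ge0; klra|exact: sqr_ge0].
rewrite /sW expr2; klra.
Qed.

Lemma sP1_lt0 : sP 1 < 0.
Proof.
(* Expanded in k and l - k, the polynomial has coefficients of one sign, with an overall factor l -
   k. *)
pose t := l - k; have t0 : 0 < t by rewrite /t; klra.
have -> : sP 1 = - (t * (t ^+ 2 + 2 * t ^+ 3 + 6 * k * t + 20 * k * t ^+ 2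
   + 4 * k * t ^+ 3 + 9 * k ^+ 2 + 66 * k ^+ 2 * t + 36 * k ^+ 2 * t ^+ 2
   + 72 * k ^+ 3 + 108 * k ^+ 3 * t + 108 * k ^+ 4)).
  by rewrite /sP /sV /sW /sD /t; ring.
rewrite oppr_lt0; apply: mulr_gt0 => //.
by do 10 (apply: ltr_wpDr; first by rewrite !mulr_ge0 ?exprn_ge0 // ltW); apply: exprn_gt0.
Qed.

(* sP is negative at 1 exactly because k < l, and positive where v <= 0, which happens
   both near 0 and near infinity. *)
Lemma sP_root_lt1 : exists y, [/\ 0 < y, y < 1 & sP y = 0].
Proof.
(* Chosen so that (4k + 2l + 2) a is the constant term of [sD], which is at most [sD a]. *)
pose a := (3 * k + 1) / (4 * k + 2 * l + 2).
have c0 : 0 < 4 * k + 2 * l + 2 by klra.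
have a0 : 0 < a by apply: divr_gt0 => //; klra.
have a1 : a < 1 by rewrite ltr_pdivrMr // mul1r; klra.
have Pa : 0 < sP a.
  apply: sP_gt0 => //; apply: sV_le0 => //.
  rewrite [leLHS](_ : _ = 3 * k + 1) /sD; first by have := lsqr_ge0 a; klra.
  by rewrite /a mulrCA mulfV ?gt_eqF // mulr1.
have [|y /andP[ay y1] /rootP] := @poly_ivt _ (- sP_poly) a 1 (ltW a1).
  by rewrite !hornerN !horner_sP oppr_le0 oppr_ge0 (ltW Pa) (ltW sP1_lt0).
rewrite hornerN horner_sP => /eqP; rewrite oppr_eq0 => /eqP Py.
exists y; split=> //; first exact: lt_le_trans ay.
rewrite lt_neqAle y1 andbT; apply/eqP => e; move: sP1_lt0.
by rewrite -e Py ltxx.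
Qed.

Lemma sP_root_gt1 : exists y, 1 < y /\ sP y = 0.
Proof.
have l0 : 0 < l by klra.
(* Chosen so that (4k + 2l + 2) b = l b^2, the quadratic term of [sD b]. *)
pose b := (4 * k + 2 * l + 2) / l.
have b1 : 1 < b by rewrite ltr_pdivlMr // mul1r; klra.
have Pb : 0 < sP b.
  have b0 : 0 < b by klra.
  apply: sP_gt0 => //; apply: sV_le0 => //.
  have e : 4 * k + 2 * l + 2 = l * b by rewrite /b mulrCA mulfV ?gt_eqF // mulr1.
  by rewrite e /sD -mulrA -expr2; klra.
have [|y /andP[y1 yb] /rootP] := @poly_ivt _ sP_poly 1 b (ltW b1).
  by rewrite !horner_sP (ltW Pb) (ltW sP1_lt0).
rewrite horner_sP => Py; exists y; split=> //.
rewrite lt_neqAle y1 andbT; apply/eqP => e; move: sP1_lt0.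
by rewrite e Py ltxx.
Qed.

Lemma sP_root_einstein y : 0 < y -> sP y = 0 -> exists u v lambda,
  [/\ 0 < u, 0 < v, u != y & [/\
  k + 1 + k * (u ^+ 2 / y ^+ 2) + l * u ^+ 2 = lambda * u,
  l + 1 + 2 * k * v ^+ 2 = lambda * v,
  4 * k + 2 - (2 * k + 1) * (u / y) + l * y ^+ 2 = lambda * y &
  4 * k + 2 * l + 2 - k * (u + y) - l * v - (u + v) / 2 = lambda]].
Proof.
move=> y0 Py.
have D0 := sD_gt0 y; have l0 : 0 < l by klra.
(* Positivity of v: otherwise [sP y] would be positive and not a root. *)
have V0 : 0 < sV y.
  by rewrite ltNge; apply/negP => /(sP_gt0 y0); rewrite Py ltxx.
have yn : y != 0 by rewrite gt_eqF.
have Dn : sD y != 0 by rewrite gt_eqF.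
have ln : 2 * l + 1 != 0 by rewrite gt_eqF //; klra.
have u0 : 0 < (k + 1) * y / sD y by rewrite divr_gt0 // mulr_gt0 //; klra.
exists ((k + 1) * y / sD y), (sV y / ((2 * l + 1) * (y * sD y))), (sW y / (y * sD y)).
split=> //.
- by rewrite divr_gt0 // !mulr_gt0 //; klra.
(* Here u < y, because k + 1 < [sD y]. *)
- rewrite lt_eqF // ltr_pdivrMr // mulrC ltr_pM2l // /sD; have := lsqr_ge0 y; klra.
split.
- by rewrite /sW; field; rewrite yn Dn.
- apply/eqP; rewrite -subr_eq0; apply/eqP.
  (* The sp(l) equation is the one not solved by the choice of u, v and lambda; up to a nonzero
     denominator it is [sP y = 0]. *)
  transitivity (sP y / ((2 * l + 1) * (y * sD y)) ^+ 2).
    by rewrite /sP; field; rewrite yn Dn ln.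
  by rewrite Py mul0r.
- transitivity (sW y / sD y); last by field; rewrite yn Dn.
  move: Dn; rewrite /sW /sD => Dn; by field; rewrite yn Dn.
- by rewrite /sV; field; rewrite yn Dn ln.
Qed.

End Solutions.

(** * Natural reductivity *)

Section CommutingMaps.
Variables (R : realType) (n : nat).
Local Notation M := 'M[quat R]_n.
Implicit Types (A B C X Y Z : M) (i j r : 'I_n).

Definition skew_herm X := qadj X = - X.

Lemma skew_mdot_eq0 X : skew_herm X -> (forall C, skew_herm C -> mdot X C = 0) -> X = 0.
Proof. by move=> eX h; apply: mdot_eq0; exact: h. Qed.

Lemma skew_hermB X Y : skew_herm X -> skew_herm Y -> skew_herm (X - Y).
Proof. by rewrite /skew_herm => eX eY; rewrite qadjD qadjN eX eY opprD. Qed.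

Lemma skew_hermD X Y : skew_herm X -> skew_herm Y -> skew_herm (X + Y).
Proof. by rewrite /skew_herm => eX eY; rewrite qadjD eX eY opprD. Qed.

Definition rotgen i j : M := qE i j 1 - qE j i 1.

Lemma skew_rotgen i j : skew_herm (rotgen i j).
Proof. by rewrite /skew_herm /rotgen qadjD qadjN !qadj_qE qconj1 opprB addrC. Qed.

Lemma rotgenE i j a b : rotgen i j a b =
  (if (a == i) && (b == j) then 1 else 0) - (if (a == j) && (b == i) then 1 else 0).
Proof. by rewrite !mxE. Qed.

Lemma smx_rotgen s i j : (forall i j, s i j = s j i) ->
  smx s (rotgen i j) = smx (fun _ _ => s i j) (rotgen i j).
Proof. by move=> sC; rewrite /rotgen smxD smxN (qE_smx s i) (qE_smx s j) (sC j i) -smxN -smxD. Qed.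

Lemma skew_qE i e : qre e = 0 -> skew_herm (qE i i e).
Proof.
move=> e0; rewrite /skew_herm qadj_qE (_ : qconj e = - e); last first.
  by apply: quatP; rewrite !qcE e0 oppr0.
by apply/matrixP => a b; rewrite !mxE; case: ifP => _; rewrite ?oppr0.
Qed.

Definition unit_i : quat R := mkquat 0 1 0 0.
Definition unit_j : quat R := mkquat 0 0 1 0.

(** i and j generate the quaternions, whose centre is real. *)
Lemma quat_comm_real (p : quat R) : p * unit_i = unit_i * p -> p * unit_j = unit_j * p ->
  p = qre p *: (1 : quat R).
Proof.
move=> hi hj.
have := congr1 (@qk R) hi; have := congr1 (@qj R) hi.
have := congr1 (@qk R) hj; have := congr1 (@qi R) hj.
rewrite /unit_i /unit_j !qcE => h1 h2 h3 h4.
by apply: quatP; rewrite !qcE; split; lra.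
Qed.

Lemma quat_comm_imag (p : quat R) : p * unit_i = unit_i * p -> p * unit_j = unit_j * p ->
  qre p = 0 -> p = 0.
Proof. by move=> hi hj p0; rewrite (quat_comm_real hi hj) p0 scale0r. Qed.

Lemma quat_mul_unit_i_eq0 (p : quat R) : p * unit_i = 0 -> p = 0.
Proof.
move=> h.
have := congr1 (@qk R) h; have := congr1 (@qj R) h.
have := congr1 (@qi R) h; have := congr1 (@qre R) h.
rewrite /unit_i !qcE => h1 h2 h3 h4.
by apply: quatP; rewrite !qcE; split; lra.
Qed.

Lemma rotgen_qE_comm i j r e : r != i -> r != j -> mxbr (rotgen i j) (qE r r e) = 0.
Proof.
move=> /negPf ri /negPf rj; apply/matrixP => a b; rewrite qE_mxbr [RHS]mxE.
by rewrite !rotgenE ri rj !andbF /= subrr mulr0 mul0r; do 2 case: ifP => _; rewrite subr0.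
Qed.

Lemma rotgen_qE2_comm i j e : i != j -> mxbr (rotgen i j) (qE i i e + qE j j e) = 0.
Proof.
move=> ij; have ji : j != i by rewrite eq_sym.
rewrite mxbrDr; apply/matrixP => a b; rewrite [LHS]mxE !qE_mxbr [RHS]mxE !rotgenE !eqxx.
rewrite (negPf ij) (negPf ji) !andbF !andbT.
case: (a == i); case: (a == j); case: (b == i); case: (b == j);
  rewrite /= !(subr0, sub0r, mulr0, mul0r, mulr1, mul1r, mulrN, mulNr, addr0,
    add0r, oppr0, subrr, addNr, opprK) //.
by rewrite -opprD addNr.
Qed.

(** The double centralizer of a rotation in sp(n) is its real span. Two kinds of test matrices
    suffice: imaginary diagonal units outside the plane, and equal imaginary entries at (i, i) and
    (j, j). *)
Lemma centralizer_rotgen i j X : i != j -> skew_herm X ->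
  (forall Z, skew_herm Z -> mxbr (rotgen i j) Z = 0 -> mxbr X Z = 0) ->
  X = smx (fun _ _ => qre (X i j)) (rotgen i j).
Proof.
move=> ij eX hX; have ji : j != i by rewrite eq_sym.
(* Units outside the plane annihilate the columns other than i and j. *)
have X0 r a : r != i -> r != j -> X a r = 0.
  move=> ri rj.
  have hq e : qre e = 0 -> mxbr X (qE r r e) a r = 0.
    by move=> e0; rewrite hX ?mxE //; [exact: skew_qE|exact: rotgen_qE_comm].
  have [ar|ar] := eqVneq a r.
    move: hq; rewrite ar => hq; apply: quat_comm_imag; last exact: qre_skew.
    - by apply/eqP; rewrite -subr_eq0 -(hq unit_i) ?qmkE // qE_mxbr eqxx.
    - by apply/eqP; rewrite -subr_eq0 -(hq unit_j) ?qmkE // qE_mxbr eqxx.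
  apply: quat_mul_unit_i_eq0; rewrite -(hq unit_i) ?qmkE // qE_mxbr eqxx (negPf ar).
  by rewrite subr0.
have hq e a b : qre e = 0 -> (mxbr X (qE i i e) + mxbr X (qE j j e)) a b = 0.
  move=> e0; rewrite -mxbrDr hX ?mxE //; last exact: rotgen_qE2_comm.
  by apply: skew_hermD; exact: skew_qE.
(* The second kind of test matrix makes the entries inside the plane commute with imaginary
   quaternions, hence real. *)
have comm a b e : (a == i) || (a == j) -> (b == i) || (b == j) -> qre e = 0 ->
    X a b * e = e * X a b.
  move=> ha hb e0; have := hq e a b e0; rewrite mxE !qE_mxbr => h.
  apply/eqP; rewrite -subr_eq0 -h.
  case/orP: ha => /eqP ->; case/orP: hb => /eqP ->;
    by rewrite ?eqxx ?(negPf ij) ?(negPf ji) ?subr0 ?sub0r ?add0r ?addr0 // addrC.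
have ii : (i == i) || (i == j) by rewrite eqxx.
have jj : (j == i) || (j == j) by rewrite eqxx orbT.
have Xii : X i i = 0 by apply: quat_comm_imag; [apply: comm|apply: comm|apply: qre_skew]; rewrite ?qmkE.
have Xjj : X j j = 0 by apply: quat_comm_imag; [apply: comm|apply: comm|apply: qre_skew]; rewrite ?qmkE.
have Xij : X i j = qre (X i j) *: (1 : quat R) by apply: quat_comm_real; apply: comm; rewrite ?qmkE.
have Xji : X j i = - (qre (X i j) *: (1 : quat R)).
  by rewrite (skewE i j eX) {1}Xij qconjZ qconj1.
apply/matrixP => a b; rewrite smxE rotgenE.
have [bi|bi] := eqVneq b i; have [bj|bj] := eqVneq b j.
- by move: ij; rewrite -bi bj eqxx.
- rewrite bi andbF sub0r andbT; have [->|aj] := eqVneq a j; first by rewrite Xji scalerN.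
  rewrite oppr0 scaler0; have [->|ai] := eqVneq a i; first exact: Xii.
  by rewrite (skewE i a eX) X0 // qconj0 oppr0.
- rewrite bj andbF subr0 andbT; have [->|ai] := eqVneq a i; first exact: Xij.
  rewrite scaler0; have [->|aj] := eqVneq a j; first exact: Xjj.
  by rewrite (skewE j a eX) X0 // qconj0 oppr0.
- by rewrite !andbF subr0 scaler0 X0.
Qed.

Variable T : M -> M.
Hypotheses (skewT : forall A, skew_herm A -> skew_herm (T A))
  (commT : forall A B, skew_herm A -> skew_herm B -> mxbr (T A) B = mxbr A (T B)).

(* With B the trace form, B([TA,X],C) = B([A,TX],C) = B(A,[TX,C]) = B(A,[X,TC])
   = B([A,X],TC) up to sign. *)
Lemma commuting_centralizer A X : skew_herm A -> skew_herm X -> mxbr A X = 0 ->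
  mxbr (T A) X = 0.
Proof.
move=> eA eX h; apply: skew_mdot_eq0; first exact: qadj_mxbr (skewT eA) eX.
move=> C eC; rewrite commT // (mxbrC A) mdotNl (mdot_brl _ _ (skewT eX)) opprK commT //.
by rewrite mdotC (mdot_brl _ _ eX) (mxbrC X) h oppr0 mdotC mdot0l oppr0.
Qed.

Lemma commuting_rotgen i j : i != j -> exists t, T (rotgen i j) = smx (fun _ _ => t) (rotgen i j).
Proof.
move=> ij; exists (qre (T (rotgen i j) i j)); apply: centralizer_rotgen => //.
  by apply: skewT; exact: skew_rotgen.
by move=> Z eZ; apply: commuting_centralizer => //; exact: skew_rotgen.
Qed.

Lemma mxbr_rotgen i j r : i != j -> i != r -> j != r ->
  mxbr (rotgen i r) (rotgen i j) j r = 1.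
Proof.
move=> ij ir jr; rewrite /rotgen mxbrDr mxbrNr [LHS]mxE [in X in _ + X]mxE !qE_mxbr -/(rotgen i r).
have ji : j != i by rewrite eq_sym.
have ri : r != i by rewrite eq_sym.
have rj : r != j by rewrite eq_sym.
rewrite !rotgenE !eqxx ?(negPf ij, negPf ir, negPf jr, negPf ji, negPf ri, negPf rj) /=.
by rewrite !subr0 mul1r !sub0r opprK.
Qed.

(** Both eigenvalues multiply the same bracket of the two rotations in [commT], and [mxbr_rotgen]
    exhibits a nonzero entry of it. *)
Lemma commuting_rotgen2 i j r : i != j -> i != r -> j != r -> exists t,
  T (rotgen i j) = smx (fun _ _ => t) (rotgen i j) /\
  T (rotgen i r) = smx (fun _ _ => t) (rotgen i r).
Proof.
move=> ij ir jr; have [t ht] := commuting_rotgen ij; have [t' ht'] := commuting_rotgen ir.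
exists t; split=> //; rewrite ht'; congr (smx (fun _ _ => _) _).
have /matrixP/(_ j r) := commT (skew_rotgen i r) (skew_rotgen i j).
rewrite ht ht' mxbr_scalel mxbr_scale !smxE mxbr_rotgen //.
by move=> /(congr1 (@qre R)); rewrite !qcE !mulr1 => ->.
Qed.

End CommutingMaps.

(** * Derivatives at 0 of curves of quaternionic matrices *)

Section Derivatives.
Variable R : realType.

Definition der0 (f : R -> R) (df : R) := is_derive (0 : R) (1 : R) f df.

Lemma der0_eq (f : R -> R) df df' : der0 f df -> df = df' -> der0 f df'.
Proof. by move=> hf <-. Qed.

Lemma der0_cst c : der0 (fun=> c) 0.
Proof. exact: is_derive_cst. Qed.

Lemma der0D (f h : R -> R) df dh : der0 f df -> der0 h dh -> der0 (fun t => f t + h t) (df + dh).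
Proof. by move=> hf hh; exact: is_deriveD. Qed.

Lemma der0N (f : R -> R) df : der0 f df -> der0 (fun t => - f t) (- df).
Proof. by move=> hf; exact: is_deriveN. Qed.

Lemma der0B (f h : R -> R) df dh : der0 f df -> der0 h dh -> der0 (fun t => f t - h t) (df - dh).
Proof. by move=> hf hh; exact: is_deriveB. Qed.

Lemma der0M (f h : R -> R) df dh : der0 f df -> der0 h dh ->
  der0 (fun t => f t * h t) (df * h 0 + f 0 * dh).
Proof.
move=> hf hh; apply: der0_eq; first exact: (is_deriveM hf hh).
by rewrite addrC /GRing.scale /= (mulrC (h 0)).
Qed.

Lemma der0_sum (I : finType) (F : I -> R -> R) (dF : I -> R) :
  (forall i, der0 (F i) (dF i)) -> der0 (fun t => \sum_i F i t) (\sum_i dF i).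
Proof.
move=> hF; rewrite /index_enum; elim: (Finite.enum I) => [|i s IH].
  rewrite big_nil (_ : (fun t => _) = fun=> 0); first exact: der0_cst.
  by apply/funext => t; rewrite big_nil.
rewrite big_cons (_ : (fun t => _) = fun t => F i t + \sum_(j <- s) F j t).
  exact: der0D.
by apply/funext => t; rewrite big_cons.
Qed.

Lemma der0_unique (f : R -> R) df df' : der0 f df -> der0 f df' -> df = df'.
Proof. by move=> h1 h2; rewrite -(@derive_val _ _ _ _ _ _ _ h1) (@derive_val _ _ _ _ _ _ _ h2). Qed.

Definition qder (f : R -> quat R) (df : quat R) :=
  forall c, der0 (fun t => qcoord (f t) c) (qcoord df c).

Lemma qder4 (f : R -> quat R) df : der0 (fun t => qre (f t)) (qre df) ->
  der0 (fun t => qi (f t)) (qi df) -> der0 (fun t => qj (f t)) (qj df) ->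
  der0 (fun t => qk (f t)) (qk df) -> qder f df.
Proof.
move=> h0 h1 h2 h3 [[|[|[|[|//]]]] lt_c].
- have -> : Ordinal lt_c = inord 0 by apply/val_inj; rewrite /= inordK.
  exact: h0.
- have -> : Ordinal lt_c = inord 1 by apply/val_inj; rewrite /= inordK.
  exact: h1.
- have -> : Ordinal lt_c = inord 2 by apply/val_inj; rewrite /= inordK.
  exact: h2.
- have -> : Ordinal lt_c = inord 3 by apply/val_inj; rewrite /= inordK.
  exact: h3.
Qed.

Lemma qder_conj (f : R -> quat R) df : qder f df -> qder (fun t => qconj (f t)) (qconj df).
Proof.
move=> hf; apply: qder4.
- rewrite qre_conj (_ : (fun t => _) = fun t => qre (f t)); first exact: hf.
  by apply/funext => t; rewrite qre_conj.
- rewrite qi_conj (_ : (fun t => _) = fun t => - qi (f t)); first exact/der0N/hf.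
  by apply/funext => t; rewrite qi_conj.
- rewrite qj_conj (_ : (fun t => _) = fun t => - qj (f t)); first exact/der0N/hf.
  by apply/funext => t; rewrite qj_conj.
- rewrite qk_conj (_ : (fun t => _) = fun t => - qk (f t)); first exact/der0N/hf.
  by apply/funext => t; rewrite qk_conj.
Qed.

Lemma qder_mul (f h : R -> quat R) df dh : qder f df -> qder h dh ->
  qder (fun t => f t * h t) (df * h 0 + f 0 * dh).
Proof.
move=> hf hh.
apply: qder4.
- rewrite (_ : (fun t => _) = fun t => qre (f t) * qre (h t) - qi (f t) * qi (h t)
      - qj (f t) * qj (h t) - qk (f t) * qk (h t)); last first.
    by apply/funext => t; rewrite qreM.
  apply: der0_eq.
    apply: der0B; first apply: der0B; first apply: der0B;
      by apply: der0M; [apply: hf|apply: hh].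
  by rewrite !qcE -!/(qre _) -!/(qi _) -!/(qj _) -!/(qk _); ring.
- rewrite (_ : (fun t => _) = fun t => qre (f t) * qi (h t) + qi (f t) * qre (h t)
      + qj (f t) * qk (h t) - qk (f t) * qj (h t)); last first.
    by apply/funext => t; rewrite qiM.
  apply: der0_eq.
    apply: der0B; first apply: der0D; first apply: der0D;
      by apply: der0M; [apply: hf|apply: hh].
  by rewrite !qcE -!/(qre _) -!/(qi _) -!/(qj _) -!/(qk _); ring.
- rewrite (_ : (fun t => _) = fun t => qre (f t) * qj (h t) - qi (f t) * qk (h t)
      + qj (f t) * qre (h t) + qk (f t) * qi (h t)); last first.
    by apply/funext => t; rewrite qjM.
  apply: der0_eq.
    apply: der0D; first apply: der0D; first apply: der0B;
      by apply: der0M; [apply: hf|apply: hh].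
  by rewrite !qcE -!/(qre _) -!/(qi _) -!/(qj _) -!/(qk _); ring.
- rewrite (_ : (fun t => _) = fun t => qre (f t) * qk (h t) + qi (f t) * qj (h t)
      - qj (f t) * qi (h t) + qk (f t) * qre (h t)); last first.
    by apply/funext => t; rewrite qkM.
  apply: der0_eq.
    apply: der0D; first apply: der0B; first apply: der0D;
      by apply: der0M; [apply: hf|apply: hh].
  by rewrite !qcE -!/(qre _) -!/(qi _) -!/(qj _) -!/(qk _); ring.
Qed.

Lemma qcoord_sum (I : finType) (F : I -> quat R) c :
  qcoord (\sum_i F i) c = \sum_i qcoord (F i) c.
Proof.
exact: (big_morph (fun q => qcoord q c) (fun p q => qcoordD p q c) (qcoord0 R c)).
Qed.

Lemma qder_sum (I : finType) (F : I -> R -> quat R) (dF : I -> quat R) :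
  (forall i, qder (F i) (dF i)) -> qder (fun t => \sum_i F i t) (\sum_i dF i).
Proof.
move=> hF c; rewrite qcoord_sum.
rewrite (_ : (fun t => _) = fun t => \sum_i qcoord (F i t) c).
  by apply: der0_sum => i; exact: hF.
by apply/funext => t; rewrite qcoord_sum.
Qed.

Variable n : nat.
Local Notation M := 'M[quat R]_n.

Definition mder (F : R -> M) (dF : M) := forall i j, qder (fun t => F t i j) (dF i j).

Lemma mder_cst A : mder (fun=> A) 0.
Proof. by move=> i j c; rewrite mxE qcoord0; exact: der0_cst. Qed.

Lemma mder_mul F G dF dG : mder F dF -> mder G dG ->
  mder (fun t => F t *m G t) (dF *m G 0 + F 0 *m dG).
Proof.
move=> hF hG i j.
rewrite (_ : (fun t => _) = fun t => \sum_k F t i k * G t k j); last first.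
  by apply/funext => t; rewrite mxE.
rewrite !mxE -big_split; apply: qder_sum => k.
by apply: qder_mul; [exact: hF|exact: hG].
Qed.

Lemma mder_adj F dF : mder F dF -> mder (fun t => qadj (F t)) (qadj dF).
Proof.
move=> hF i j; rewrite (_ : (fun t => _) = fun t => qconj (F t j i)).
  by rewrite !mxE; apply: qder_conj; exact: hF.
by apply/funext => t; rewrite !mxE.
Qed.

Lemma qadj1 : qadj 1%:M = 1%:M :> M.
Proof.
apply/matrixP => i j; rewrite !mxE eq_sym.
by case: eqP => _; rewrite ?qconj1 ?qconj0.
Qed.

Lemma mder_conj G dG A : mder G dG -> G 0 = 1%:M ->
  mder (fun t => G t *m A *m qadj (G t)) (dG *m A + A *m qadj dG).
Proof.
move=> hG G0.
have := mder_mul (mder_mul hG (mder_cst A)) (mder_adj hG).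
by rewrite G0 !mul1mx addr0 qadj1 mulmx1.
Qed.

Lemma mder_mdot F dF A : mder F dF -> der0 (fun t => mdot (F t) A) (mdot dF A).
Proof.
move=> hF; rewrite mdotE.
rewrite (_ : (fun t => _) = fun t => \sum_i \sum_j qdot (F t i j) (A i j)); last first.
  by apply/funext => t; rewrite mdotE.
apply: der0_sum => i; apply: der0_sum => j.
apply: der0_eq.
  rewrite /qdot; apply: der0D; first apply: der0D; first apply: der0D;
    by apply: der0M; [apply: hF|apply: der0_cst].
by rewrite !mulr0 !addr0.
Qed.

End Derivatives.

(** * One-parameter subgroups and the Lie algebra of K *)

Section OneParameter.
Variables (R : realType) (n : nat).
Local Notation M := 'M[quat R]_n.
Local Notation g := (sp R n).
Variable K : set M.
Hypothesis KP : closed_subgroup K.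

Lemma subgroup_Sp a : K a -> qadj a *m a = 1%:M.
Proof. by case: KP => KSp _ _ _ _ /KSp. Qed.

Lemma subgroup_adj a : K a -> K (qadj a).
Proof. by case: KP => _ _ _ _; apply. Qed.

Lemma one_parameter0 (gam : R -> M) : (forall t, K (gam t)) ->
  (forall s t, gam (s + t) = gam s *m gam t) -> gam 0 = 1%:M.
Proof.
move=> Kg gM; have := congr1 (mulmx (qadj (gam 0))) (gM 0 0).
by rewrite addr0 mulmxA (subgroup_Sp (Kg 0)) mul1mx => <-.
Qed.

(** The derivatives of Ad(gam t) and of its inverse at 0 are ad x and - ad x, by the product rule
    and x^* = - x. *)
Lemma in_lie_conj x : in_lie K x -> exists gam : R -> M,
  [/\ forall t, K (gam t),
      forall A, mder (fun t => gam t *m A *m qadj (gam t)) (mxbr (mat x) A) &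
      forall A, mder (fun t => qadj (gam t) *m A *m gam t) (- mxbr (mat x) A)].
Proof.
move=> [gam [Kg gM gD]]; exists gam; have g0 := one_parameter0 Kg gM.
have gd : mder gam (mat x) by exact: gD.
split=> // A.
  have := mder_conj A gd g0; rewrite qadj_mat mulmxN mxbrE.
  exact.
have := mder_conj A (mder_adj gd); rewrite g0 qadj1 => /(_ erefl).
rewrite !qadjK qadj_mat mulNmx mxbrE opprB addrC.
by under eq_fun do rewrite qadjK.
Qed.

Lemma Ad_in_lie a x : K a -> in_lie K x -> in_lie K (Ad a x).
Proof.
case: (KP) => _ _ _ KM _ Ka [gam [Kg gM gD]].
have Ka' := subgroup_adj Ka.
exists (fun t => a *m gam t *m qadj a); split.
- by move=> t; apply: (KM) => //; exact: KM.
- move=> s t; rewrite gM -!mulmxA (mulmxA (qadj a) a) (subgroup_Sp Ka) mul1mx.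
  by rewrite !mulmxA.
have gd : mder gam (mat x) by exact: gD.
have := mder_mul (mder_mul (mder_cst a) gd) (mder_cst (qadj a)).
rewrite mul0mx add0r mulmx0 addr0 => h i j c.
have -> : vsval (Ad a x) = a *m mat x *m qadj a :> M by exact: val_Ad.
exact: h.
Qed.

(** The infinitesimal form of Ad(K)-invariance: Lambda commutes with ad x for x in the Lie algebra
    of K. *)
Lemma Ad_invariant_ad s x : (forall i j, s i j = s j i) -> Ad_invariant K (dip s) ->
  in_lie K x -> forall A, skew_herm A -> smx s (mxbr (mat x) A) = mxbr (mat x) (smx s A).
Proof.
move=> sC inv /in_lie_conj [gam [Kg gD gD']] A eA.
have sk X : skew_herm X -> skew_herm (smx s X) by exact: skew_smx.
have exA : skew_herm (mxbr (mat x) A) by exact: qadj_mxbr (qadj_mat x) eA.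
have exsA : skew_herm (mxbr (mat x) (smx s A)) by apply: qadj_mxbr (qadj_mat x) (sk _ eA).
apply/eqP; rewrite -subr_eq0; apply/eqP; apply: skew_mdot_eq0.
  by apply: skew_hermB => //; exact: sk.
move=> B eB; rewrite mdotBl mdot_smxl (mdot_brl (smx s A) B (qadj_mat x)) opprK.
have e1 := mder_mdot (smx s B) (gD A).
have e2 := mder_mdot (smx s A) (gD' B).
(* By invariance <Ad(gam t) A, B> = <A, Ad(gam t)^-1 B>, so both sides are the derivative at 0 of
   one function, with the curve in a single argument. *)
have e : mdot (mxbr (mat x) A) (smx s B) = mdot (- mxbr (mat x) B) (smx s A).
  apply: der0_unique e1 _; move: e2; congr der0; apply/funext => t.
  have Kt := Kg t; have Kt' := subgroup_adj Kt.
  pose a := Ad (gam t) (mksp A).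
  have := inv _ Kt' a (mksp B); rewrite /dip /a !mat_Ad !mat_mksp // !qadjK.
  have -> : qadj (gam t) *m (gam t *m A *m qadj (gam t)) *m gam t = A.
    rewrite !mulmxA (subgroup_Sp Kt) mul1mx -mulmxA (subgroup_Sp Kt) mulmx1 //.
  by rewrite [LHS]mdotC => ->; rewrite mdot_smxl.
by rewrite e mdotNl mdotC addNr.
Qed.

(* Ad(gam t) y stays in the linear subspace k, hence so does its velocity [x, y]. *)
Lemma lie_closed (k : {vspace g}) : (forall x, x \in k <-> in_lie K x) ->
  forall x y, x \in k -> y \in k -> sp_br x y \in k.
Proof.
move=> kP x y /kP /in_lie_conj [gam [Kg gD _]] yk.
(* Coordinates of the component of w off k: linear forms that vanish on k and jointly detect
   membership in it. *)
pose f i j c (w : g) := ev i j c (w - projv k w).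
have fD i j c w w' : f i j c (w + w') = f i j c w + f i j c w'.
  by rewrite /f -evD; congr ev; rewrite linearD opprD addrACA.
have fZ i j c a w : f i j c (a *: w) = a * f i j c w.
  by rewrite /f -evZ; congr ev; rewrite linearZ scalerBr.
have f0 i j c w : w \in k -> f i j c w = 0.
  by move=> wk; rewrite /f projv_id // subrr ev0.
suff fxy i j c : f i j c (sp_br x y) = 0.
  suff /eqP : sp_br x y - projv k (sp_br x y) = 0.
    by rewrite subr_eq0 => /eqP ->; exact: memv_proj.
  by rewrite [LHS]sp_unit !big1 // => i _; rewrite big1 // => j _;
    rewrite big1 // => c _; rewrite [ev _ _ _ _]fxy scale0r.
rewrite (linear_spE (fD i j c) (fZ i j c)).
(* Expanding f in the spanning family shows that its value at [x, y] is the derivative of f(Ad(gam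
   t) y), which is constantly 0. *)
have h1 : der0 (fun t => f i j c (Ad (gam t) y))
    (\sum_a \sum_b \sum_e ev a b e (sp_br x y) * f i j c (spE R a b e)).
  rewrite (_ : (fun t => _) = fun t => \sum_a \sum_b \sum_e
      ev a b e (Ad (gam t) y) * f i j c (spE R a b e)); last first.
    by apply/funext => t; exact: linear_spE.
  apply: der0_sum => a; apply: der0_sum => b; apply: der0_sum => e.
  apply: der0_eq.
    apply: der0M; last exact: der0_cst.
    rewrite (_ : (fun t => _) = fun t =>
       qcoord ((gam t *m mat y *m qadj (gam t)) a b) e); last first.
      by apply/funext => t; rewrite /ev mat_Ad.
    exact: gD.
  by rewrite mulr0 addr0 -mat_br.
apply: der0_unique h1 _; rewrite (_ : (fun t => _) = fun=> 0); first exact: der0_cst.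
apply/funext => t; apply: f0; apply/kP; apply: Ad_in_lie => //.
exact/kP.
Qed.

End OneParameter.

(** * The obstruction to natural reductivity *)

Section NaturallyReductiveObstruction.
Variables (R : realType) (n : nat).
Local Notation M := 'M[quat R]_n.
Local Notation g := (sp R n).
Variable s : 'I_n -> 'I_n -> R.
Hypotheses (sC : forall i j, s i j = s j i) (s_gt0 : forall i j, 0 < s i j).

Let si i j : R := (s i j)^-1.

(* The complement m of a natural reduction is the graph of a map phi : g -> k, and
   psi = id + phi. *)
Lemma naturally_reductive_graph : naturally_reductive (@dip R n s) ->
  exists (K : set M) (k : {vspace g}) (phi : g -> g),
  [/\ closed_subgroup K, Ad_invariant K (dip s),
      forall x, x \in k <-> in_lie K x, forall x, phi x \in k &
      forall w u v, dip s (sp_br w (u + phi u)) v + dip s u (sp_br w (v + phi v)) = 0].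
Proof.
move=> [K [KP [inv [k [gk [h [m [kP gkP hP [mh mh0] [_ nat]]]]]]]]].
exists K, k, (fun x => (daddv_pi m h (x, 0)).2).
pose P x : g * g := daddv_pi m h (x, 0).
have Pm x : P x \in m by exact: memv_pi.
have m_gk x : x \in m -> x.2 \in k.
  by move=> xm; apply/gkP; rewrite -mh; move: xm; exact/subvP/addvSl.
(* The isotropy algebra h is diagonal, so [orbit_diff] does not see the h-component. *)
have diff x : x \in (m + h)%VS ->
    orbit_diff (daddv_pi m h x) = orbit_diff x.
  move=> xg; rewrite -[in RHS](daddv_pi_add mh0 xg) /orbit_diff /=.
  have /hP [-> _] : daddv_pi h m x \in h by exact: memv_pi.
  by rewrite opprD addrACA subrr addr0.
(* Hence the m-component of (x, 0) is (x + phi x, phi x). *)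
have Pdiff x : (P x).1 = x + (P x).2.
  apply/eqP; rewrite -subr_eq; apply/eqP; have := diff (x, 0).
  rewrite /orbit_diff /= subr0; apply; rewrite mh; apply/gkP; exact: mem0v.
have phik x : (P x).2 \in k by exact: m_gk.
split=> // w u v.
have ad z a b : z \in k -> dip s (sp_br z a) b + dip s a (sp_br z b) = 0.
  move=> /kP zk; rewrite /dip !mat_br.
  rewrite (Ad_invariant_ad KP sC inv zk (qadj_mat a)).
  by rewrite (mdot_brl _ _ (qadj_mat z)) addNr.
have brk z : orbit_diff (daddv_pi m h (prod_br (P w) (P z))) =
    sp_br w (z + (P z).2) + sp_br (P w).2 z.
  rewrite diff; last first.
    by rewrite mh; apply/gkP; rewrite /=; exact: lie_closed (kP) _ _ _ _.
  rewrite /orbit_diff /= !Pdiff; apply: mat_inj.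
  rewrite (matB (sp_br _ _)) (matD (sp_br _ _)) !mat_br !matD !mxbrDl !mxbrDr.
  by rewrite addrA addrK.
have od z : orbit_diff (P z) = z by rewrite /orbit_diff Pdiff addrK.
have dipDl a b c : dip s (a + b) c = dip s a c + dip s b c.
  by rewrite /dip (matD a) smxD mdotDl.
have dipDr a b c : dip s c (a + b) = dip s c a + dip s c b.
  by rewrite /dip (matD a) mdotDr.
(* The extra summand [phi w, -] in [brk] is skew for the metric, as phi w lies in k, and drops
   out. *)
have cancel_ad a a' b b' : dip s a' v + dip s u b' = 0 ->
    dip s (a + a') v + dip s u (b + b') = 0 -> dip s a v + dip s u b = 0.
  by move=> e; rewrite (dipDl a) (dipDr b) addrACA e addr0.
apply: (cancel_ad _ _ _ _ (ad _ u v (phik w))).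
apply: etrans (nat _ _ _ (Pm w) (Pm u) (Pm v)).
by congr (dip s _ _ + dip s _ _); apply: esym;
  [exact: brk|exact: od|exact: od|exact: brk].
Qed.

(** The inequality [s i j != s i r] keeps t from equalling both inverse weights, so k contains one
    of the two rotations. The inequalities with [s i i] and [s j r] exclude the rotation (i, j) and
    the rotation (i, r), respectively. *)
Lemma not_naturally_reductive (i j r : 'I_n) : i != j -> i != r -> j != r ->
  s i j != s i i -> s i j != s i r -> s i j != s j r ->
  ~ naturally_reductive (dip s).
Proof.
move=> ij ir jr nii nir njr /naturally_reductive_graph.
move=> [K [k [phi [KP inv kP phik hphi]]]].
have siC a b : si a b = si b a by rewrite /si sC.
have smx_si (A : M) : smx s (smx si A) = A.
  apply/matrixP => a b; rewrite !smxE scalerA mulfV ?scale1r //.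
  by rewrite gt_eqF.
(* [u] is Lambda^-1: pairing with [u A] in the metric is pairing with [A] in the trace form. *)
pose u A : g := mksp (smx si A).
have mu A : skew_herm A -> smx s (mat (u A)) = A.
  by move=> eA; rewrite /u mat_mksp ?smx_si //; exact: skew_smx.
have d1 x A : skew_herm A -> dip s x (u A) = mdot (mat x) A.
  by move=> eA; rewrite /dip mdot_smxl mu.
pose T A : M := mat (u A + phi (u A)).
have skewT A : skew_herm A -> skew_herm (T A) by move=> _; exact: qadj_mat.
have commT A B : skew_herm A -> skew_herm B -> mxbr (T A) B = mxbr A (T B).
  move=> eA eB; apply/eqP; rewrite -subr_eq0 (mxbrC A) opprK; apply/eqP.
  apply: skew_mdot_eq0.
    by apply: skew_hermD; apply: qadj_mxbr => //; exact: skewT.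
  move=> C eC; rewrite mdotDl (mdot_brl B C (skewT A eA)) (mdot_brl A C (skewT B eB)).
  rewrite (mxbrC (T A)) (mxbrC (T B)) !mdotNr !opprK.
  rewrite (mdotC B) (mdotC A); apply: etrans (hphi (mksp C) (u A) (u B)).
  congr (_ + _).
    by rewrite (d1 _ _ eB) mat_br (mat_mksp eC).
  by rewrite dipC (d1 _ _ eA) mat_br (mat_mksp eC).
have [t [hij hir]] := commuting_rotgen2 skewT commT ij ir jr.
have phi_rot a b : T (rotgen R a b) = smx (fun _ _ => t) (rotgen R a b) ->
    mat (phi (u (rotgen R a b))) = smx (fun _ _ => t - si a b) (rotgen R a b).
  rewrite /T (matD (u _)) {1}/u mat_mksp; last exact/skew_smx/skew_rotgen.
  rewrite smx_rotgen // => h; apply/matrixP => c d; rewrite smxE scalerBl.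
  by move/matrixP/(_ c d): h; rewrite mxE !smxE => <-; rewrite (addrC (si a b *: _)) addrK.
have lie_commute a b : t - si a b != 0 -> T (rotgen R a b) = smx (fun _ _ => t) (rotgen R a b) ->
    forall A, skew_herm A -> smx s (mxbr (rotgen R a b) A) = mxbr (rotgen R a b) (smx s A).
  move=> tn hab A eA.
  have /kP hk := phik (u (rotgen R a b)).
  have := Ad_invariant_ad KP sC inv hk eA; rewrite (phi_rot _ _ hab).
  rewrite !mxbr_scalel smx_scale => h; apply/matrixP => c d.
  have /matrixP/(_ c d) := h.
  by rewrite (smxE _ (smx s _)) (smxE _ (mxbr _ (smx s A))) => /(scalerI tn).
(* If t is the inverse of [s i j], then k contains the rotation (i, r). Testing Lambda on its
   bracket with the rotation (i, j) gives [s j r = s i j]. *)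
have [tij|tij] := eqVneq (t - si i j) 0.
  have tir : t - si i r != 0.
    apply/eqP => tir; have /invr_inj e : si i j = si i r.
      by rewrite -(subr0_eq tij) (subr0_eq tir).
    by move: nir; rewrite e eqxx.
  have /matrixP/(_ j r) := lie_commute _ _ tir hir _ (skew_rotgen R i j).
  rewrite smx_rotgen // mxbr_scale !smxE mxbr_rotgen // => /(congr1 (@qre R)).
  by rewrite !qcE !mulr1 => e; move: njr; rewrite e eqxx.
(* Otherwise k contains the rotation (i, j), and testing it on an imaginary diagonal unit at (i, i)
   gives [s i j = s i i]. *)
have q0 : qre (unit_i R) = 0 by rewrite qmkE.
have /matrixP/(_ i j) := lie_commute _ _ tij hij _ (skew_qE i q0).
rewrite qE_smx mxbr_scale !smxE qE_mxbr eqxx eq_sym (negPf ij).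
rewrite rotgenE !eqxx (negPf ij) /= subr0 mulr1 sub0r => /(congr1 (@qi R)).
rewrite /unit_i !qcE !mulrN1 => /oppr_inj e.
by move: nii; rewrite e eqxx.
Qed.

End NaturallyReductiveObstruction.

(** * Distinct homothety classes and conclusion *)

Lemma mdot_rotgen_neq0 (R : realType) n (i j : 'I_n) : i != j ->
  mdot (rotgen R i j) (rotgen R i j) != 0.
Proof.
move=> ij; apply/eqP => /mdot_eq0 /matrixP /(_ i j) /(congr1 (@qre R)).
rewrite rotgenE !eqxx (negPf ij) /= mxE !qcE subr0 => /eqP.
by rewrite oner_eq0.
Qed.

Lemma dip_rotgen (R : realType) n (s : 'I_n -> 'I_n -> R) (i j : 'I_n) :
  (forall i j, s i j = s j i) ->
  dip s (mksp (rotgen R i j)) (mksp (rotgen R i j)) =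
  s i j * mdot (rotgen R i j) (rotgen R i j).
Proof.
move=> sC; rewrite /dip mat_mksp; last exact: skew_rotgen.
by rewrite smx_rotgen // mdot_scale.
Qed.

(** The weight between blocks 1 and 3 is normalised to 1 in both metrics, which forces the factor c
    = 1; the weights between blocks 1 and 2 must then agree. *)
Lemma homothetic_bs (R : realType) (k l : nat) (u v y u' v' y' : R) :
  (0 < k)%N -> (0 < l)%N ->
  homothetic (dip (@bs R k l u v y)) (dip (@bs R k l u' v' y')) -> y = y'.
Proof.
move=> k0 l0 [c _ h].
pose i := lshift l (lshift k (Ordinal k0)).
pose j := lshift l (rshift k (Ordinal k0)).
pose r := rshift (k + k) (Ordinal l0).
have ij : i != j by rewrite -val_eqE /= addn0 eq_sym -lt0n.
have ir : i != r by rewrite -val_eqE /= addn0 eq_sym -lt0n addn_gt0 k0.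
have bC w x z := @bsC R k l w x z.
have := h (mksp (rotgen R i r)) (mksp (rotgen R i r)).
rewrite !dip_rotgen // mulrA => /(mulIf (mdot_rotgen_neq0 _ ir)).
have bs_ir w x z : bs w x z i r = 1 :> R by rewrite /bs blk0 blk2 /bw !inord3E.
rewrite !bs_ir mulr1 => c1.
have := h (mksp (rotgen R i j)) (mksp (rotgen R i j)).
rewrite -c1 mul1r !dip_rotgen // => /(mulIf (mdot_rotgen_neq0 _ ij)).
by rewrite /bs blk0 blk1 /bw !inord3E.
Qed.

Lemma bs_not_naturally_reductive (R : realType) (k l : nat) (u v y : R) :
  (0 < k)%N -> (0 < l)%N -> 0 < u -> 0 < v -> 0 < y -> u != y -> y != 1 ->
  ~ naturally_reductive (dip (@bs R k l u v y)).
Proof.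
move=> k0 l0 u0 v0 y0 uy y1.
(* One index from each block. *)
pose i := lshift l (lshift k (Ordinal k0)).
pose j := lshift l (rshift k (Ordinal k0)).
pose r := rshift (k + k) (Ordinal l0).
apply: (@not_naturally_reductive _ _ _ (@bsC _ _ _ _ _ _) (bs_gt0 u0 v0 y0) i j r).
- by rewrite -val_eqE /= addn0 eq_sym -lt0n.
- by rewrite -val_eqE /= addn0 eq_sym -lt0n addn_gt0 k0.
- by rewrite -val_eqE /= !addn0 neq_ltn -{1}[k]addn0 ltn_add2l k0.
- by rewrite /bs blk0 blk1 /bw !inord3E // eq_sym.
- by rewrite /bs blk0 blk1 blk2 /bw !inord3E.
- by rewrite /bs blk0 blk1 blk2 /bw !inord3E.
Qed.

Lemma einstein_of_root (R : realType) (k l : nat) (y : R) :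
  (0 < k)%N -> (k < l)%N -> 0 < y -> y != 1 -> sP k%:R l%:R y = 0 -> exists u v,
  let ip := dip (@bs R k l u v y) in
  [/\ inner_product ip, Ad_invariant (block_Sp R k k l) ip,
      einstein (@sp_br R (k + k + l)) ip & ~ naturally_reductive ip].
Proof.
move=> k0 kl y0 y1 Py; have l0 : (0 < l)%N by exact: leq_trans kl.
have K0 : 0 < k%:R :> R by rewrite ltr0n.
have KL : k%:R < l%:R :> R by rewrite ltr_nat.
have [u [v [lambda [u0 v0 uy [e1 e2 e3 e4]]]]] := sP_root_einstein K0 KL y0 Py.
exists u, v; split.
- exact: dip_inner (bs_gt0 u0 v0 y0).
- exact: Ad_invariant_blocks.
- exact: einstein_blocks u0 v0 y0 e1 e2 e3 e4.
- exact: bs_not_naturally_reductive.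
Qed.

Theorem theorem1p5 (R : realType) (k l : nat) (hk : (0 < k)%N) (hkl : (k < l)%N) :
  exists ip1 ip2 : sp R (k + k + l) -> sp R (k + k + l) -> R,
  [/\ [/\ inner_product ip1, Ad_invariant (block_Sp R k k l) ip1,
          einstein (@sp_br R (k + k + l)) ip1 & ~ naturally_reductive ip1],
      [/\ inner_product ip2, Ad_invariant (block_Sp R k k l) ip2,
          einstein (@sp_br R (k + k + l)) ip2 & ~ naturally_reductive ip2] &
      ~ homothetic ip1 ip2].
Proof.
have K0 : 0 < k%:R :> R by rewrite ltr0n.
have KL : k%:R < l%:R :> R by rewrite ltr_nat.
(* One root on each side of 1: both avoid the excluded value 1, and they differ from each other. *)
have [y [y0 y1 Py]] := sP_root_lt1 K0 KL.
have [y' [y'1 Py']] := sP_root_gt1 K0 KL.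
have yn1 : y != 1 by rewrite lt_eqF.
have y'n1 : y' != 1 by rewrite gt_eqF.
have y'0 : 0 < y' by exact: lt_trans y'1.
have [u [v h]] := einstein_of_root hk hkl y0 yn1 Py.
have [u' [v' h']] := einstein_of_root hk hkl y'0 y'n1 Py'.
exists (dip (bs u v y)), (dip (bs u' v' y')); split=> //.
move=> /(homothetic_bs hk (leq_trans hk (ltnW hkl))) e.
by move: (lt_trans y1 y'1); rewrite e ltxx.
Qed.
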